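(* Let $a,c\ge 0$, and let $B\subset\mathbb K$ be a compact set of scalars. Assume that a Banach space $X$ is a strict $(a,B,c)$-ideal in $X^{**}$. If $X$ has a shrinking Markushevich basis, then $X$ admits an equivalent smooth norm $|\cdot|$ whose dual norm on $X^*$ is strictly convex and such that $(X,|\cdot|)$ is a canonical $(a,B,c)$-ideal in its bidual $(X,|\cdot|)^{**}$.
   Context: Banach spaces are over $\mathbb K=\mathbb R$ or $\mathbb C$; $X$ is regarded as a subspace of $X^{**}$ (and $X^*$ of $X^{***}$) via the canonical embedding. A closed subspace $X$ of a Banach space $Z$ is an ideal in $Z$ if there is a contractive (norm at most $1$) linear projection $P$ on $Z^*$ with $\ker P=X^\perp=\{z^*\in Z^*: z^*|_X=0\}$; such a $P$ is called an ideal projection. Given $a,c\ge 0$ and a compact set $B\subset\mathbb K$, $X$ is an $(a,B,c)$-ideal in $Z$ if it is an ideal in $Z$ with an ideal projection $P$ such that $\|az^*+bPz^*\|+c\|Pz^*\|\le\|z^*\|$ for all $b\in B$ and all $z^*\in Z^*$. It is called strict if such a $P$ can be taken whose range is norming, i.e. $\|z\|=\sup\{|u(z)|: u\in\operatorname{ran}P,\ \|u\|\le 1\}$ for all $z\in Z$. It is called canonical if $Z=X^{**}$ and $P=\pi_X$, where $\pi_X\colon X^{***}\to X^{***}$ is the natural projection onto $X^*$ (restriction of a functional on $X^{**}$ to $X$, followed by the canonical embedding $X^*\to X^{***}$). A shrinking Markushevich basis of $X$ consists of families $(x_i)_{i\in I}$ in $X$ and $(f_i)_{i\in I}$ in $X^*$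 with $f_i(x_j)=\delta_{ij}$, $\overline{\operatorname{span}}(x_i)=X$, $\overline{\operatorname{span}}(f_i)=X^*$ (norm closures), where, if $X$ is infinite-dimensional, $I$ has cardinality equal to the density character of $X$. A Banach space $X$ is smooth if for every $x\in S_X$ there is a unique $f_x\in S_{X^*}$ with $f_x(x)=1$ ($S$ denotes the unit sphere). A norm is strictly convex if its unit sphere contains no non-trivial line segments. *)

(* Defs.v *)
From HB Require Import structures.
From mathcomp Require Import all_boot all_order all_algebra.
From mathcomp Require Import all_classical all_reals all_analysis.
From mathcomp Require Import complex.

Set Implicit Arguments.
Unset Strict Implicit.
Unset Printing Implicit Defensive.

Import Order.TTheory GRing.Theory Num.Theory.
Import numFieldNormedType.Exports.

Local Open Scope classical_set_scope.
Local Open Scope card_scope.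
Local Open Scope ring_scope.

Inductive scalar_kind := RealScalars | ComplexScalars.

Definition scalars (R : realType) (k : scalar_kind) : numFieldType :=
  match k with RealScalars => R | ComplexScalars => R[i] end.

Section scalars.
Context {R : realType} {k : scalar_kind}.
Local Notation K := (scalars R k).

Definition sc_re : K -> R :=
  match k return scalars R k -> R with
  | RealScalars => id
  | ComplexScalars => fun z => complex.Re z
  end.

Definition sc_of : R -> K :=
  match k return R -> scalars R k with
  | RealScalars => id
  | ComplexScalars => fun r => (r%:C)%C
  end.

(* The order of [K] is partial when [K] is complex. A norm takes its values in
   the real elements of [K]; this is the supremum of a bounded set of those. *)
Definition sc_sup (A : set K) : K := sc_of (sup (sc_re @` A)).

Lemma sc_ofK (r : R) : sc_re (sc_of r) = r.
Proof. by rewrite /sc_re /sc_of; case: k. Qed.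

Lemma sc_reK (x : K) : 0 <= x -> sc_of (sc_re x) = x.
Proof.
rewrite /sc_re /sc_of; case: k x => //= -[a b]; rewrite lecE /=.
by case/andP => /eqP -> _.
Qed.

Lemma ler_sc_of (r s : R) : (sc_of r <= sc_of s :> K) = (r <= s).
Proof. by rewrite /sc_of; case: k => //=; rewrite lecR. Qed.

Lemma ler_sc_re (x y : K) : x <= y -> sc_re x <= sc_re y.
Proof.
rewrite /sc_re; case: k x y => //= -[a b] [c d]; rewrite lecE /=.
by case/andP.
Qed.

Lemma le_sc_sup (A : set K) (M x : K) : A `<=` [set x | 0 <= x <= M] -> A x ->
  x <= sc_sup A.
Proof.
move=> AM Ax; have /andP[x0 _] := AM _ Ax.
rewrite -[leLHS](sc_reK x0) ler_sc_of; apply: ub_le_sup; last by exists x.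
exists (sc_re M) => _ [y /AM/andP[_ yM] <-]; exact: ler_sc_re.
Qed.

Lemma ge_sc_sup (A : set K) (M : K) : A !=set0 ->
  A `<=` [set x | 0 <= x <= M] -> sc_sup A <= M.
Proof.
move=> [a Aa] AM; have /andP[a0 aM] := AM _ Aa.
rewrite -[leRHS](sc_reK (le_trans a0 aM)) ler_sc_of.
apply: ge_sup; first by exists (sc_re a), a.
by move=> _ [y /AM/andP[_ yM] <-]; exact: ler_sc_re.
Qed.

End scalars.

Section dual.
Context {R : realType} {k : scalar_kind}.
Local Notation K := (scalars R k).
Variable V : normedModType K.

Definition dual_pred : {pred V -> K^o} :=
  [pred f : V -> K^o | `[< linear f /\ continuous f >]].

Lemma dual_predP (f : V -> K^o) :
  reflect (linear f /\ continuous f) (f \in dual_pred).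
Proof. exact: asboolP. Qed.

Lemma dual_pred_submod_closed : submod_closed dual_pred.
Proof.
split=> [|a f g /dual_predP[lf cf] /dual_predP[lg cg]]; apply/dual_predP.
  split=> [b x y|x]; last exact: cst_continuous.
  by rewrite /= scaler0 addr0.
split=> [b x y|x].
  rewrite !fctE lf lg !scalerDr !scalerA (mulrC a b) -!addrA.
  by congr (_ + _); rewrite addrCA.
apply: continuousD; last exact: cg.
by apply: continuousZl_tmp; exact: cf.
Qed.

HB.instance Definition _ :=
  GRing.isSubmodClosed.Build K (V -> K^o) dual_pred dual_pred_submod_closed.

Record dual := Dual { dual_fun :> V -> K^o; _ : dual_fun \in dual_pred }.

HB.instance Definition _ := [isSub for dual_fun].
HB.instance Definition _ := [Choice of dual by <:].
HB.instance Definition _ := [SubChoice_isSubLmodule of dual by <:].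

Lemma dual_linear (f : dual) : linear f.
Proof. by case: f => f /= /dual_predP[]. Qed.

Lemma dual_continuous (f : dual) : continuous f.
Proof. by case: f => f /= /dual_predP[]. Qed.

HB.instance Definition _ (f : dual) :=
  GRing.isLinear.Build K V K^o *:%R (dual_fun f) (dual_linear f).

Lemma dualP (f g : dual) : f =1 g -> f = g.
Proof. by move=> fg; apply: val_inj; apply/funext. Qed.

Lemma dualDE (f g : dual) x : (f + g) x = f x + g x.
Proof. by []. Qed.

Lemma dualZE (a : K) (f : dual) x : (a *: f) x = a * f x.
Proof. by []. Qed.

Lemma bounded_dual_pred (f : V -> K^o) (M : K) : linear f ->
  0 <= M -> (forall x, `|f x| <= M * `|x|) -> f \in dual_pred.
Proof.
move=> lf M0 fM; apply/dual_predP; split=> //.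
pose F := GRing.isLinear.Build K V K^o *:%R f lf.
pose g : {linear V -> K^o} := HB.pack f F.
apply: (@bounded_linear_continuous _ _ _ g); apply/linear_boundedP.
exists M; split; first exact: ger0_real.
by move=> r Mr x; apply: le_trans (fM x) _; apply: ler_wpM2r => //; exact: ltW.
Qed.

Lemma dual_bounded (f : dual) :
  exists2 M : K, 0 <= M & forall x, `|f x| <= M * `|x|.
Proof.
have /linear_boundedP : bounded_near f (nbhs (0 : V)).
  by apply/linear_bounded_continuous; exact: dual_continuous.
by move=> /pinfty_ex_gt0[M M0 fM]; exists M => //; exact: ltW.
Qed.

Definition dual_norm (f : dual) : K :=
  sc_sup [set `|f x| | x in [set x : V | `|x| <= 1]].

Let ball_neq0 (f : dual) :
  [set `|f x| | x in [set x : V | `|x| <= 1]] !=set0.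
Proof. by exists `|f 0|, 0 => //=; rewrite normr0. Qed.

Lemma dual_norm_ge0 (f : dual) : 0 <= dual_norm f.
Proof.
have [M M0 fM] := dual_bounded f.
rewrite (_ : 0 = `|f 0|); last by rewrite linear0 normr0.
apply: (@le_sc_sup _ _ _ M); last by exists 0 => //=; rewrite normr0.
move=> _ [x /= x1 <-]; rewrite normr_ge0 /=.
by apply: le_trans (fM x) _; rewrite -[leRHS]mulr1 ler_wpM2l.
Qed.

Lemma le_dual_norm (f : dual) x : `|f x| <= dual_norm f * `|x|.
Proof.
have [M M0 fM] := dual_bounded f.
have [->|x0] := eqVneq x 0; first by rewrite linear0 !normr0 mulr0.
have nx0 : 0 < `|x| by rewrite normr_gt0.
rewrite -ler_pdivrMr// -[X in _ / X](normr_id x) -normfV mulrC -normrM.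
rewrite (_ : _ * _ = f (`|x|^-1 *: x)); last by rewrite linearZ.
apply: (@le_sc_sup _ _ _ M).
  move=> _ [y /= y1 <-]; rewrite normr_ge0 /=.
  by apply: le_trans (fM y) _; rewrite -[leRHS]mulr1 ler_wpM2l.
exists (`|x|^-1 *: x) => //=.
by rewrite normrZ normfV normr_id mulVf ?gt_eqF.
Qed.

Lemma dual_norm_le (f : dual) (M : K) : 0 <= M ->
  (forall x, `|f x| <= M * `|x|) -> dual_norm f <= M.
Proof.
move=> M0 fM; apply: ge_sc_sup => // _ [y /= y1 <-]; rewrite normr_ge0 /=.
by apply: le_trans (fM y) _; rewrite -[leRHS]mulr1 ler_wpM2l.
Qed.

Let dual_normD (f g : dual) : dual_norm (f + g) <= dual_norm f + dual_norm g.
Proof.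
apply: dual_norm_le => [|x]; first by rewrite addr_ge0 ?dual_norm_ge0.
rewrite mulrDl; apply: le_trans (ler_normD _ _) _.
by apply: lerD; exact: le_dual_norm.
Qed.

Let dual_normZ_le (a : K) (f : dual) :
  dual_norm (a *: f) <= `|a| * dual_norm f.
Proof.
apply: dual_norm_le => [|x]; first by rewrite mulr_ge0 ?dual_norm_ge0.
by rewrite dualZE normrM -mulrA ler_wpM2l ?le_dual_norm.
Qed.

Let dual_normZ (a : K) (f : dual) : dual_norm (a *: f) = `|a| * dual_norm f.
Proof.
apply/eqP; rewrite eq_le dual_normZ_le /=.
have [->|a0] := eqVneq a 0; first by rewrite normr0 mul0r dual_norm_ge0.
rewrite -ler_pdivlMl ?normr_gt0// -normfV.
by apply: le_trans (dual_normZ_le _ _); rewrite scalerA mulVf// scale1r.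
Qed.

Let dual_norm_eq0 (f : dual) : dual_norm f = 0 -> f = 0.
Proof.
move=> f0; apply: dualP => x; apply/normr0_eq0/eqP.
by rewrite eq_le normr_ge0 andbT -(mul0r `|x|) -f0 le_dual_norm.
Qed.

HB.instance Definition _ := Lmodule_isNormed.Build K dual
  dual_normD dual_normZ dual_norm_eq0.

Lemma dual_normE (f : dual) : `|f| = dual_norm f.
Proof. by []. Qed.

End dual.

Section canonical_embedding.
Context {R : realType} {k : scalar_kind}.
Local Notation K := (scalars R k).
Variable X : normedModType K.

Lemma evaluation_dual_pred (x : X) :
  (fun f : dual X => f x) \in @dual_pred _ _ (dual X).
Proof.
apply: (@bounded_dual_pred _ _ _ _ `|x|) => // f.
by rewrite mulrC; exact: le_dual_norm.
Qed.

Definition bidual_embedding (x : X) : dual (dual X) :=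
  Dual (evaluation_dual_pred x).

Lemma bidual_embedding_le (x : X) : `|bidual_embedding x| <= `|x|.
Proof.
apply: dual_norm_le => // f /=; rewrite mulrC; exact: le_dual_norm.
Qed.

Lemma restriction_dual_pred (phi : dual (dual (dual X))) :
  (fun x => phi (bidual_embedding x)) \in @dual_pred _ _ X.
Proof.
apply: (@bounded_dual_pred _ _ _ _ `|phi|) => // [a x y|x].
  rewrite -linearP; congr (phi _); apply: dualP => f.
  by rewrite dualDE dualZE /= linearP.
apply: le_trans (le_dual_norm _ _) _.
by rewrite ler_wpM2l ?dual_norm_ge0 ?bidual_embedding_le.
Qed.

Definition restriction (phi : dual (dual (dual X))) : dual X :=
  Dual (restriction_dual_pred phi).

End canonical_embedding.

Section ideals.
Context {R : realType} {k : scalar_kind}.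
Local Notation K := (scalars R k).

Definition closed_subspace (Z : normedModType K) (Y : set Z) : Prop :=
  [/\ closed Y, Y 0 & forall (a : K) u v, Y u -> Y v -> Y (a *: u + v)].

Definition annihilator (Z : normedModType K) (Y : set Z) : set (dual Z) :=
  [set f | forall y, Y y -> f y = 0].

Definition norming (Z : normedModType K) (W : set (dual Z)) : Prop :=
  forall z : Z, `|z| = sc_sup [set `|u z| | u in W `&` [set u | `|u| <= 1]].

Definition ideal_projection (Z : normedModType K) (Y : set Z)
    (P : dual Z -> dual Z) : Prop :=
  [/\ linear P, forall f, P (P f) = P f, forall f, `|P f| <= `|f|
    & P @^-1` [set 0] = annihilator Y].

(* The constants [a] and [c] are meant to satisfy [0 <= a] and [0 <= c], which in
   [K] means that they are nonnegative real numbers. *)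
Definition aBc_ideal_by (a : K) (B : set K) (c : K) (Z : normedModType K)
    (Y : set Z) (P : dual Z -> dual Z) : Prop :=
  [/\ closed_subspace Y, ideal_projection Y P
    & forall b, B b -> forall f, `|a *: f + b *: P f| + c * `|P f| <= `|f|].

Definition strict_aBc_ideal (a : K) (B : set K) (c : K) (Z : normedModType K)
    (Y : set Z) : Prop :=
  exists P, aBc_ideal_by a B c Y P /\ norming (range P).

Definition natural_projection (X : normedModType K)
    (phi : dual (dual (dual X))) : dual (dual (dual X)) :=
  bidual_embedding (restriction phi).

Definition canonical_aBc_ideal (a : K) (B : set K) (c : K)
    (X : normedModType K) : Prop :=
  aBc_ideal_by a B c (range (@bidual_embedding R k X)) (@natural_projection X).

End ideals.

Section markushevich_bases.
Context {R : realType} {k : scalar_kind}.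
Local Notation K := (scalars R k).

Definition linear_span (V : lmodType K) (I : Type) (x : I -> V) : set V :=
  [set v | exists s : seq (K * I), v = \sum_(p <- s) p.1 *: x p.2].

Definition finite_dimensional (V : lmodType K) : Prop :=
  exists n (e : 'I_n -> V), linear_span e = setT.

Definition has_density_character (T : topologicalType) (I : Type) : Prop :=
  (exists2 D : set T, dense D & [set: I] #= D) /\
  forall D : set T, dense D -> [set: I] #<= D.

Definition shrinking_markushevich_basis (X : normedModType K) (I : Type)
    (x : I -> X) (f : I -> dual X) : Prop :=
  [/\ forall i, f i (x i) = 1,
      forall i j, i <> j -> f i (x j) = 0,
      closure (linear_span x) = setT,
      closure (linear_span f) = setT
    & ~ finite_dimensional X -> has_density_character X I].

Definition has_shrinking_markushevich_basis (X : normedModType K) : Prop :=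
  exists (I : Type) (x : I -> X) (f : I -> dual X),
    shrinking_markushevich_basis x f.

End markushevich_bases.

Section renormings.
Context {R : realType} {k : scalar_kind}.
Local Notation K := (scalars R k).

Definition smooth (X : normedModType K) : Prop :=
  forall x : X, `|x| = 1 -> exists! f : dual X, `|f| = 1 /\ f x = 1.

Definition strictly_convex (X : normedModType K) : Prop :=
  forall u v : X,
    (forall t : K, 0 <= t <= 1 -> `|t *: u + (1 - t) *: v| = 1) -> u = v.

Record equivalent_norm (X : normedModType K) := EquivalentNorm {
  eqnorm :> X -> K;
  eqnormD : forall x y, eqnorm (x + y) <= eqnorm x + eqnorm y;
  eqnormZ : forall (a : K) x, eqnorm (a *: x) = `|a| * eqnorm x;
  eqnorm_equiv : exists m M : K,
    [/\ 0 < m, 0 < M & forall x, m * `|x| <= eqnorm x <= M * `|x|] }.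

(* An alias of [X] that inherits only the vector space structure of [X]: its norm
   and its topology, hence its dual and its bidual, are those given by [N]. *)
Definition renormed (X : normedModType K) (N : equivalent_norm X) : Type := X.

Section renormed.
Variables (X : normedModType K) (N : equivalent_norm X).

HB.instance Definition _ := GRing.Lmodule.copy (renormed N) X.

Let eqnorm_eq0 (x : renormed N) : N x = 0 -> x = 0.
Proof.
move=> Nx0; have [m [M [m0 _ /(_ x)]]] := eqnorm_equiv N.
rewrite Nx0 pmulr_rle0// normr_le0 => /andP[/eqP].
exact.
Qed.

HB.instance Definition _ := Lmodule_isNormed.Build K (renormed N)
  (@eqnormD X N) (@eqnormZ X N) eqnorm_eq0.

Lemma renormedE (x : X) : `|x : renormed N| = N x.
Proof. by []. Qed.

End renormed.

End renormings.

(* Main.v *)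
Require Import Defs.
From mathcomp Require Import all_boot all_order all_algebra.
From mathcomp Require Import all_classical all_reals all_analysis.
From mathcomp Require Import complex ring lra.
Import Order.TTheory GRing.Theory Num.Theory.
Import numFieldNormedType.Exports.


(** The proof has two parts.

    The given norm already makes [X] a canonical ideal. An ideal projection [P]
    with norming range induces an isometry [S] of the bidual, the identity on
    [X], by [S F f = P f F]. A shrinking Markushevich basis makes [X^*] fragmented
    by the weak-star topology: each nonempty bounded set has a nonempty
    relatively weak-star open subset of small diameter
    ([weak_star_fragmented]). Apply this to a weak slice [W] of the unit ball of
    [X^*], and let [f] be a point of [W] near which [W] is small. The images
    under [P] of the ball of [X^*] are weak-star dense in the ball of [X^***],
    because [S] is isometric, and so is the ball of [X^*] itself (Goldstine);
    both facts come from Helly's theorem ([helly]). So [f] is nearly a norm limit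
    of such images, and [P f] is nearly [f]. Since these points [f] are weakly
    dense in the ball, [S] is the identity, and [P] is the natural projection
    ([ideal_projection_natural]).

    Fragmentation is proved by a game. If each weak-star neighbourhood in [A] of each
    point of [A] has points at a fixed positive distance from that point, one
    chooses points of [A] one after the other, each weak-star close to the previous ones and each, as witnessed by a vector
    of finite support, far from one element of a countable set dense in the
    combinations of the functionals [f i] with index in the supports used so far.
    A weak-star cluster point of the sequence would then be far from all
    combinations of the [f i], which are dense in [X^*].

    The renorming adds to the norm of [X^*] a seminorm [q] with two properties.
    It is strictly convex: equality in the triangle inequality for [q] holds only
    for proportional functionals. And the elements of the bidual dominated by [q]
    lie in [X]. Such a [q] is obtained from the coordinates [g (x i)], which are
    in [c_0(I)]: a weighted sum over [n] of the Euclidean norms of the [n] largest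
    coordinates ([day_norm_strict], [day_dominated_embedding]). The second
    property makes [rn g + q g] a dual norm, and it shows, since functionals
    dominated by a sum of seminorms split ([hahn_banach_split]), that the norm
    induced on [X^***] is [rn phi + q (restriction phi)]
    ([rn_renormed_tridual]). The added term depends only on the restriction to
    [X], so the ideal inequality survives ([renormed_canonical]). The new dual
    norm is strictly convex because [q] is, and smoothness of the new norm
    follows by duality. *)

Set Implicit Arguments.
Unset Strict Implicit.
Unset Printing Implicit Defensive.

Local Open Scope classical_set_scope.
Local Open Scope ring_scope.

(** * Scalars and real-valued norms *)

Section scalar_facts.
Context {R : realType} {k : scalar_kind}.
Local Notation K := (scalars R k).
Implicit Types (z w : K) (r s : R).

Lemma sc_reD z w : sc_re (z + w) = sc_re z + sc_re w.
Proof. by rewrite /sc_re; case: k z w => //= -[? ?] [? ?]. Qed.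

Lemma sc_reN z : sc_re (- z) = - sc_re z.
Proof. by rewrite /sc_re; case: k z => //= -[? ?]. Qed.

Lemma sc_reB z w : sc_re (z - w) = sc_re z - sc_re w.
Proof. by rewrite sc_reD sc_reN. Qed.

Lemma sc_re_ofM r z : sc_re (sc_of r * z) = r * sc_re z.
Proof. by rewrite /sc_re /sc_of; case: k z => //= -[x y] /=; ring. Qed.

Lemma sc_re0 : sc_re (0 : K) = 0.
Proof. by rewrite /sc_re; case: k. Qed.

Lemma sc_re_sum (T : Type) (s : seq T) (F : T -> K) :
  sc_re (\sum_(i <- s) F i) = \sum_(i <- s) sc_re (F i).
Proof.
by elim: s => [|i s IH]; rewrite ?big_nil ?sc_re0// !big_cons sc_reD IH.
Qed.

Lemma sc_ofD r s : sc_of (r + s) = sc_of r + sc_of s :> K.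
Proof. by rewrite /sc_of; case: k => //=; rewrite rmorphD. Qed.

Lemma sc_ofM r s : sc_of (r * s) = sc_of r * sc_of s :> K.
Proof. by rewrite /sc_of; case: k => //=; rewrite rmorphM. Qed.

Lemma sc_of0 : sc_of 0 = 0 :> K.
Proof. by rewrite /sc_of; case: k. Qed.

Lemma sc_of1 : sc_of 1 = 1 :> K.
Proof. by rewrite /sc_of; case: k. Qed.

Lemma sc_ofN r : sc_of (- r) = - sc_of r :> K.
Proof. by rewrite /sc_of; case: k => //=; rewrite rmorphN. Qed.

Lemma sc_ofB r s : sc_of (r - s) = sc_of r - sc_of s :> K.
Proof. by rewrite sc_ofD sc_ofN. Qed.

Lemma sc_of_ge0 r : (0 <= sc_of r :> K) = (0 <= r).
Proof. by rewrite -sc_of0 ler_sc_of. Qed.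

Lemma ltr_sc_of r s : (sc_of r < sc_of s :> K) = (r < s).
Proof.
by rewrite !lt_neqAle ler_sc_of (inj_eq (can_inj (@sc_ofK R k))).
Qed.

Lemma sc_re_gt0 z : 0 < z -> 0 < sc_re z.
Proof. by move=> z0; rewrite -ltr_sc_of sc_of0 sc_reK// ltW. Qed.

(** The real value of a norm, which lives in [K]: estimates are carried out in
    the totally ordered field [R]. *)
Definition rn (T : normedZmodType K) (x : T) : R := sc_re `|x|.

Lemma rnK (T : normedZmodType K) (x : T) : sc_of (rn x) = `|x|.
Proof. by rewrite sc_reK. Qed.

Lemma rn_ge0 (T : normedZmodType K) (x : T) : 0 <= rn x.
Proof. by rewrite -(@sc_of_ge0 (rn x)) rnK. Qed.

Lemma rn_le (T U : normedZmodType K) (x : T) (y : U) :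
  (`|x| <= `|y|) = (rn x <= rn y).
Proof. by rewrite -(@ler_sc_of R k) !rnK. Qed.

Lemma rnD (T : normedZmodType K) (x y : T) : rn (x + y) <= rn x + rn y.
Proof. by rewrite -(@ler_sc_of R k) sc_ofD !rnK ler_normD. Qed.

Lemma rnN (T : normedZmodType K) (x : T) : rn (- x) = rn x.
Proof. by rewrite /rn normrN. Qed.

Lemma rnB (T : normedZmodType K) (x y : T) : rn (x - y) <= rn x + rn y.
Proof. by rewrite -[rn y]rnN rnD. Qed.

Lemma rn_triangle (T : normedZmodType K) (x y z : T) :
  rn (x - z) <= rn (x - y) + rn (y - z).
Proof. by rewrite -(subrKA y) rnD. Qed.

Lemma rn_dist (T : normedZmodType K) (x y : T) : rn (x - y) = rn (y - x).
Proof. by rewrite /rn distrC. Qed.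

Lemma rn0 (T : normedZmodType K) : rn (0 : T) = 0.
Proof. by rewrite /rn normr0 sc_re0. Qed.

Lemma rn_eq0 (T : normedZmodType K) (x : T) : rn x = 0 -> x = 0.
Proof. by move=> x0; apply/normr0_eq0; rewrite -rnK x0 sc_of0. Qed.

Lemma rn_le0 (T : normedZmodType K) (x : T) : rn x <= 0 -> x = 0.
Proof. by move=> x0; apply: rn_eq0; apply/le_anti; rewrite x0 rn_ge0. Qed.

Lemma rn_gt0 (T : normedZmodType K) (x : T) : x <> 0 -> 0 < rn x.
Proof. by move=> x0; rewrite lt_def rn_ge0 andbT; apply/eqP => /rn_eq0. Qed.

Lemma rnZ (V : normedModType K) z (x : V) : rn (z *: x) = rn z * rn x.
Proof. by rewrite {1}/rn normrZ -[`|z|]rnK sc_re_ofM. Qed.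

Lemma rnM z w : rn (z * w) = rn z * rn w.
Proof. by rewrite {1}/rn normrM -[`|z|]rnK sc_re_ofM. Qed.

Lemma rn1 : rn (1 : K) = 1.
Proof. by rewrite /rn normr1 -sc_of1 sc_ofK. Qed.

Lemma rn_sc_of r : 0 <= r -> rn (sc_of r : K) = r.
Proof. by move=> r0; rewrite /rn ger0_norm ?sc_of_ge0// sc_ofK. Qed.

Lemma rn_sum (T : normedZmodType K) (I : Type) (s : seq I) (F : I -> T) :
  rn (\sum_(i <- s) F i) <= \sum_(i <- s) rn (F i).
Proof.
elim: s => [|i s IH]; first by rewrite !big_nil rn0.
by rewrite !big_cons (le_trans (rnD _ _))// lerD2l.
Qed.

Lemma sc_re_le z : sc_re z <= rn z.
Proof.
rewrite /rn /sc_re; case: k z => /= [x|z]; first exact: ler_norm.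
by apply: le_trans (ler_norm _) _; have := normc_ge_Re z; rewrite lecR.
Qed.

Lemma rn_le_re z r : rn z <= r -> r <= sc_re z -> z = sc_of r.
Proof.
rewrite /rn /sc_re /sc_of; case: k z => /= [x|[u v]] /=.
  by move=> xr rx; apply/le_anti; rewrite rx (le_trans (ler_norm _) xr).
move=> wr ru; have vu : u ^+ 2 + v ^+ 2 <= r ^+ 2.
  have r0 : 0 <= r by apply: le_trans wr; exact: sqrtr_ge0.
  rewrite -(@sqr_sqrtr _ (u ^+ 2 + v ^+ 2)) ?addr_ge0 ?sqr_ge0//.
  by rewrite ler_pXn2r ?nnegrE ?sqrtr_ge0.
have ur : u <= r.
  apply: le_trans wr; apply: le_trans (ler_norm _) _.
  by rewrite -sqrtr_sqr ler_sqrt ?addr_ge0 ?sqr_ge0// lerDl sqr_ge0.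
have ru' : r = u by apply/le_anti; rewrite ru ur.
have : v ^+ 2 <= 0 by move: vu; rewrite ru'; lra.
by rewrite ru' real_exprn_even_le0 ?num_real//= => /eqP ->.
Qed.

Lemma sc_phase z : exists2 t : K, rn t = 1 & t * z = sc_of (rn z).
Proof.
have [->|z0] := eqVneq z 0; first by exists 1; rewrite ?rn1// mulr0 rn0 sc_of0.
exists (`|z| / z); last by rewrite divfK// rnK.
by rewrite /rn normrM normr_id normfV mulfV ?normr_eq0// -sc_of1 sc_ofK.
Qed.

(** The real inner product on [K]. *)
Definition sc_ip : K -> K -> R :=
  match k return scalars R k -> scalars R k -> R with
  | RealScalars => fun x y => x * y
  | ComplexScalars => fun x y =>
      complex.Re x * complex.Re y + complex.Im x * complex.Im y
  end.

Lemma rn_sqr z : rn z ^+ 2 = sc_ip z z.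
Proof.
rewrite /rn /sc_ip /sc_re; case: k z => /= [x|[x y]] /=.
  by rewrite real_normK ?num_real.
by rewrite sqr_sqrtr ?addr_ge0 ?sqr_ge0// !expr2.
Qed.

Lemma sc_ipDl z z' w : sc_ip (z + z') w = sc_ip z w + sc_ip z' w.
Proof.
by rewrite /sc_ip; case: k z z' w => /= [*|[? ?] [? ?] [? ?]] /=; ring.
Qed.

Lemma sc_ipC z w : sc_ip z w = sc_ip w z.
Proof.
by rewrite /sc_ip; case: k z w => /= [*|[? ?] [? ?]] /=; ring.
Qed.

Lemma sc_ip_ofMl r z w : sc_ip (sc_of r * z) w = r * sc_ip z w.
Proof.
by rewrite /sc_ip /sc_of; case: k z w => /= [*|[? ?] [? ?]] /=; ring.
Qed.

(** The conjugate of [z] serves, the two scalar fields being treated alike. *)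
Lemma sc_ip_re z : exists z', forall w, sc_ip z w = sc_re (z' * w).
Proof.
rewrite /sc_ip /sc_re; case: k z => /= [x|[x y]]; first by exists x.
by exists (x -i* y)%C => -[u v] /=; ring.
Qed.

Lemma sc_ipDr z w w' : sc_ip z (w + w') = sc_ip z w + sc_ip z w'.
Proof. by rewrite sc_ipC sc_ipDl !(sc_ipC z). Qed.

Lemma sc_ip_ofMr r z w : sc_ip z (sc_of r * w) = r * sc_ip z w.
Proof. by rewrite sc_ipC sc_ip_ofMl sc_ipC. Qed.

(** For [a = rn z] and [b = rn w] the right-hand side is [a * b * (a + b) ^+ 2],
    so the second term on the left is the defect of the triangle inequality; it
    vanishes only when [z] and [w] are positively proportional. *)
Lemma rn_sqrD_weighted (a b : R) z w :
  a * b * rn (z + w) ^+ 2 + rn (sc_of b * z - sc_of a * w) ^+ 2 =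
  (a + b) * (b * rn z ^+ 2 + a * rn w ^+ 2).
Proof.
rewrite !rn_sqr -mulNr -sc_ofN !(sc_ipDl, sc_ipDr, sc_ip_ofMl, sc_ip_ofMr).
by rewrite (sc_ipC w z); ring.
Qed.

Lemma rn_sqrD_of (r : R) z w : rn (z + sc_of r * w) ^+ 2 =
  rn z ^+ 2 + 2 * r * sc_ip z w + r ^+ 2 * rn w ^+ 2.
Proof.
rewrite !rn_sqr !(sc_ipDl, sc_ipDr, sc_ip_ofMl, sc_ip_ofMr) (sc_ipC w z); ring.
Qed.

(** The coefficients available to the codes of the game in [play]. *)
Lemma sc_dense : exists d : nat -> K, forall z (e : R), 0 < e ->
  exists n, rn (z - d n) <= e.
Proof.
have ratR (x e : R) : 0 < e -> exists q : rat, `|x - ratr q| <= e.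
  move=> e0; have /rat_in_itvoo[q] : x - e < x + e by lra.
  rewrite in_itv/= => /andP[h1 h2]; exists q.
  by rewrite ler_norml; apply/andP; split; lra.
rewrite /rn /sc_re; case: k => /=.
  exists (fun n => ratr (odflt 0 (unpickle n : option rat))) => x e e0.
  by have [q qx] := ratR x e e0; exists (pickle q); rewrite pickleK.
exists (fun n => let q := odflt (0, 0) (unpickle n : option (rat * rat)) in
   (ratr q.1 +i* ratr q.2)%C) => -[x y] e e0.
have e20 : 0 < e / 2 by lra.
have [q1 h1] := ratR x _ e20; have [q2 h2] := ratR y _ e20.
exists (pickle (q1, q2)); rewrite pickleK /=.
rewrite -(@ler_pXn2r _ 2)// ?nnegrE ?sqrtr_ge0//; last exact: ltW.
rewrite sqr_sqrtr ?addr_ge0 ?sqr_ge0//.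
have a1 : (x - ratr q1) ^+ 2 <= (e / 2) ^+ 2.
  by rewrite -real_normK ?num_real// ler_pXn2r ?nnegrE//; lra.
have a2 : (y - ratr q2) ^+ 2 <= (e / 2) ^+ 2.
  by rewrite -real_normK ?num_real// ler_pXn2r ?nnegrE//; lra.
nra.
Qed.

End scalar_facts.

Lemma ltVle (R : realType) (r s : R) : r < s \/ s <= r.
Proof. by case: ltP => _; [left|right]. Qed.

Opaque rn.

(* Linear arithmetic on the values of norms, whatever the vectors. *)
Ltac rlra :=
  repeat match goal with
  | H : is_true ?P |- _ => match P with context[@rn] => revert H end
  | H : @eq _ ?u ?v |- _ => match constr:((u, v)) with context[@rn] => revert H end
  end;
  repeat match goal with
  | |- context[@rn ?R ?k ?T ?x] => generalize (@rn R k T x); intro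
  end;
  intros; lra.

(** * The Hahn-Banach theorem *)

Lemma le_infD (R : realType) (A B : set R) (x : R) : A !=set0 -> B !=set0 ->
  (forall a b, A a -> B b -> x <= a + b) -> x <= inf A + inf B.
Proof.
move=> A0 B0 AB; rewrite -lerBlDr; apply: lb_le_inf => // a Aa.
rewrite lerBlDl -lerBlDr; apply: lb_le_inf => // b Bb.
by rewrite lerBlDr addrC AB.
Qed.

Section hahn_banach.
Context {R : realType} {k : scalar_kind}.
Local Notation K := (scalars R k).
Variable V : lmodType K.
Implicit Types (p q : V -> R) (x y z : V).

Definition sublinear p :=
  (forall x y, p (x + y) <= p x + p y) /\
  (forall r x, 0 <= r -> p (sc_of r *: x) <= r * p x).

Definition real_linear p :=
  (forall x y, p (x + y) = p x + p y) /\
  (forall r x, p (sc_of r *: x) = r * p x).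

Lemma sublinear0 p : sublinear p -> p 0 = 0.
Proof.
move=> [pD pZ]; have := pD 0 0; have := pZ 0 0 (lexx _).
by rewrite addr0 scaler0; lra.
Qed.

Lemma sublinear_geN p x : sublinear p -> - p (- x) <= p x.
Proof.
by move=> ps; have := (ps.1 x (- x)); rewrite subrr sublinear0//; lra.
Qed.

(** The cone [S] consists of requirements [b <= G z] on a functional [G <= p];
    passing to this infimum builds them into the dominating functional. *)
Definition sublinear_above p (S : V -> R -> Prop) y : R :=
  inf [set r | exists z b, S z b /\ r = p (y + z) - b].

Definition cone_below p (S : V -> R -> Prop) :=
  [/\ S 0 0,
      forall z b z' b', S z b -> S z' b' -> S (z + z') (b + b'),
      forall r z b, 0 <= r -> S z b -> S (sc_of r *: z) (r * b)
    & forall z b, S z b -> b <= p z].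

Lemma sublinear_above_le p S y z b : sublinear p -> cone_below p S -> S z b ->
  sublinear_above p S y <= p (y + z) - b.
Proof.
move=> ps [S0 SD SZ Sp] Szb; apply: ge_inf; last by exists z, b.
exists (- p (- y)) => _ [z' [b' [Sz' ->]]].
have := ps.1 (y + z') (- y); rewrite addrAC subrr add0r.
by have := Sp _ _ Sz'; lra.
Qed.

Lemma sublinear_aboveP p S : sublinear p -> cone_below p S ->
  [/\ sublinear (sublinear_above p S),
      forall y, sublinear_above p S y <= p y
    & forall z b, S z b -> sublinear_above p S (- z) <= - b].
Proof.
move=> ps Sc; have [S0 SD SZ Sp] := Sc.
have le := sublinear_above_le _ ps Sc.
have ne y : [set r | exists z b, S z b /\ r = p (y + z) - b] !=set0.
  by exists (p (y + 0) - 0), 0, 0.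
have lep y : sublinear_above p S y <= p y by have := le y _ _ S0; rewrite addr0 subr0.
split=> //; last first.
  by move=> z b Szb; have := le (- z) _ _ Szb; rewrite addNr sublinear0// sub0r.
split=> [x y|r x].
  apply: le_infD => // _ _ [z [b [Szb ->]]] [z' [b' [Szb' ->]]].
  apply: le_trans (le _ _ _ (SD _ _ _ _ Szb Szb')) _.
  by have := ps.1 (x + z) (y + z'); rewrite addrACA; lra.
rewrite le_eqVlt => /orP[/eqP<-|r0].
  by rewrite sc_of0 scale0r mul0r (le_trans (lep _))// sublinear0.
rewrite -ler_pdivrMl//; apply: lb_le_inf => // _ [z [b [Szb ->]]].
rewrite ler_pdivrMl// mulrBr.
apply: le_trans (le _ _ _ (SZ _ _ _ (ltW r0) Szb)) _.
by rewrite -scalerDr lerD2r; apply: ps.2; exact: ltW.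
Qed.

Lemma minimal_sublinear p : sublinear p ->
  exists q, [/\ sublinear q, forall x, q x <= p x &
    forall q', sublinear q' -> (forall x, q' x <= q x) -> q' = q].
Proof.
move=> ps; pose T := {q : V -> R | sublinear q /\ forall x, q x <= p x}.
pose le (s t : T) := `[< forall x, sval t x <= sval s x >].
have [||||[q [qs qp]] qmin] := @Zorn T le.
- by move=> t; apply/asboolP.
- move=> r s t /asboolP rs /asboolP st; apply/asboolP => x.
  exact: le_trans (rs x).
- move=> [s Ps] [t Pt] /asboolP/= st /asboolP/= ts.
  by apply/eq_exist/funext => x; apply/le_anti; rewrite st ts.
- move=> A Atot; have [->|/set0P[t0 At0]] := eqVneq A set0.
    by exists (exist _ p (conj ps (fun x => lexx (p x)))).
  pose m x := inf [set sval t x | t in A].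
  have ne x : [set sval t x | t in A] !=set0 by exists (sval t0 x), t0.
  have mle t x : A t -> m x <= sval t x.
    move=> At; apply: ge_inf; last by exists t.
    exists (- p (- x)) => _ [[s [ss sp]] _ <-] /=.
    by have := sublinear_geN x ss; have := sp (- x); lra.
  have ms : sublinear m.
    split=> [x y|r x r0].
      apply: le_infD => // _ _ [s As <-] [t At <-].
      have [/asboolP st|/asboolP ts] := Atot _ _ As At.
        apply: le_trans (mle _ _ At) _; apply: le_trans ((svalP t).1.1 x y) _ => //.
        by rewrite lerD2r.
      apply: le_trans (mle _ _ As) _; apply: le_trans ((svalP s).1.1 x y) _ => //.
      by rewrite lerD2l.
    move: r0; rewrite le_eqVlt => /orP[/eqP<-|r0].
      rewrite sc_of0 scale0r mul0r (le_trans (mle _ _ At0))//.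
      by rewrite (sublinear0 (svalP t0).1).
    rewrite -ler_pdivrMl//; apply: lb_le_inf => // _ [t At <-].
    rewrite ler_pdivrMl//; apply: le_trans (mle _ _ At) _.
    by apply: (svalP t).1.2; exact: ltW.
  have mp x : m x <= p x by apply: le_trans (mle _ _ At0) _; exact: (svalP t0).2.
  by exists (exist _ m (conj ms mp)) => s As; apply/asboolP => x /=; exact: mle.
- exists q; split=> // q' q's q'q.
  have q'p x : q' x <= p x by exact: le_trans (q'q x) (qp x).
  by have /(congr1 sval) := qmin (exist _ q' (conj q's q'p)) (asboolT q'q).
Qed.

(** For each [x], imposing [r * q x <= q (sc_of r *: x)] for all [r >= 0] gives a
    sublinear functional below [q], hence [q] itself by minimality; this says
    that [q] is superadditive. *)
Lemma minimal_sublinear_linear q : sublinear q ->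
  (forall q', sublinear q' -> (forall x, q' x <= q x) -> q' = q) ->
  real_linear q.
Proof.
move=> qs qmin.
have qD x y : q (x + y) = q x + q y.
  pose S z b := exists r : R, [/\ 0 <= r, z = sc_of r *: x & b = r * q x].
  have Sq r : 0 <= r -> r * q x <= q (sc_of r *: x).
    rewrite le_eqVlt => /orP[/eqP<-|r0].
      by rewrite sc_of0 scale0r mul0r sublinear0.
    have := qs.2 r^-1 (sc_of r *: x); rewrite scalerA -sc_ofM.
    by rewrite mulVf ?gt_eqF// sc_of1 scale1r ler_pdivlMl//; apply; rewrite invr_ge0 ltW.
  have Sc : cone_below q S.
    split.
    - by exists 0; rewrite sc_of0 scale0r mul0r.
    - move=> _ _ _ _ [r [r0 -> ->]] [s [s0 -> ->]]; exists (r + s).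
      by rewrite addr_ge0// sc_ofD scalerDl mulrDl.
    - move=> r _ _ r0 [s [s0 -> ->]]; exists (r * s).
      by rewrite mulr_ge0// sc_ofM scalerA mulrA.
    - by move=> _ _ [r [r0 -> ->]]; exact: Sq.
  have [q's q'q _] := sublinear_aboveP qs Sc.
  have Sx : S x (q x) by exists 1; rewrite sc_of1 scale1r mul1r.
  have := sublinear_above_le y qs Sc Sx; rewrite (qmin _ q's q'q) (addrC y).
  by have := qs.1 x y; move=> h1 h2; apply/le_anti; rewrite h1/=; lra.
have qN x : q (- x) = - q x.
  by have := qD x (- x); rewrite subrr sublinear0//; lra.
have qZ r x : 0 <= r -> q (sc_of r *: x) = r * q x.
  move=> r0; apply/le_anti; rewrite qs.2//=.
  by have := qs.2 _ (- x) r0; rewrite scalerN !qN; lra.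
split=> // r x; have [r0|r0] := leP 0 r; first exact: qZ.
rewrite -[in LHS](opprK r) sc_ofN scaleNr qN qZ ?oppr_ge0 ?ltW//.
by rewrite mulNr opprK.
Qed.

(** The Mazur-Orlicz form of the Hahn-Banach theorem: a minimal sublinear
    functional below [sublinear_above p S] is linear. *)
Lemma mazur_orlicz p S : sublinear p -> cone_below p S ->
  exists G, [/\ real_linear G, forall x, G x <= p x &
    forall z b, S z b -> b <= G z].
Proof.
move=> ps Sc; have [p's p'p Sp'] := sublinear_aboveP ps Sc.
have [q [qs qp' qmin]] := minimal_sublinear p's.
have ql := minimal_sublinear_linear qs qmin.
exists q; split=> // [x|z b Szb]; first exact: le_trans (qp' x) (p'p x).
have := Sp' _ _ Szb; have := qp' (- z).
by have := ql.2 (-1) z; rewrite sc_ofN sc_of1 scaleN1r; lra.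
Qed.

Lemma real_linear_complexify G : real_linear G ->
  exists F : V -> K^o, linear F /\ forall x, sc_re (F x) = G x.
Proof.
case=> GD GZ; move: V G GD GZ; rewrite /sc_re /sc_of.
case: k => /= W G GD GZ.
  by exists G; split=> // a x y; rewrite GD GZ.
have GN (x : W) : G (- x) = - G x.
  by rewrite -scaleN1r; have := GZ (-1) x; rewrite rmorphN rmorph1 mulN1r.
exists (fun x : W => (G x -i* G ('i *: x))%C : R[i]); split=> // a x y.
have GZC (b : R[i]) (z : W) :
    G (b *: z) = complex.Re b * G z + complex.Im b * G ('i%C *: z).
  by rewrite {1}[b]complexE scalerDl GD GZ (mulrC 'i%C) -scalerA GZ.
have swap : 'i%C *: (a *: x) = a *: ('i%C *: x) by rewrite !scalerA mulrC.
rewrite scalerDr swap !GD !(GZC a) scalerA -expr2 sqr_i scaleN1r GN.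
move: (G x) (G y) (G ('i%C *: x)) (G ('i%C *: y)) => gx gy hx hy.
case: a {swap} => u v; apply/eqP; rewrite eq_complex /=.
by apply/andP; split; apply/eqP; ring.
Qed.

Definition seminorm p :=
  (forall x y, p (x + y) <= p x + p y) /\
  (forall a x, p (a *: x) = rn a * p x).

Lemma seminorm_sublinear p : seminorm p -> sublinear p.
Proof. by move=> [pD pZ]; split=> // r x r0; rewrite pZ rn_sc_of. Qed.

Lemma seminorm_ge0 p x : seminorm p -> 0 <= p x.
Proof.
move=> ps; have := sublinear_geN x (seminorm_sublinear ps).
by rewrite -scaleN1r ps.2 rnN rn1; lra.
Qed.

(** A unimodular multiple of [x] makes the value of [F] real and positive. *)
Lemma rn_le_seminorm p (F : V -> K^o) : seminorm p -> linear F ->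
  (forall x, sc_re (F x) <= p x) -> forall x, rn (F x) <= p x.
Proof.
move=> [_ pZ] Fl Fp x; have [t t1 tF] := sc_phase (F x).
have FZ : F (t *: x) = t * F x.
  have F0 : F 0 = 0 by have := Fl (-1) 0 0; rewrite scaler0 addr0 scaleN1r addNr.
  by have := Fl t x 0; rewrite addr0 F0 addr0.
by have := Fp (t *: x); rewrite FZ tF sc_ofK pZ t1 mul1r.
Qed.

Lemma hahn_banach_norming p x : seminorm p ->
  exists F : V -> K^o, [/\ linear F, forall y, rn (F y) <= p y & F x = sc_of (p x)].
Proof.
move=> ps; have psl := seminorm_sublinear ps.
pose S z b := exists r : R, [/\ 0 <= r, z = sc_of r *: x & b = r * p x].
have Sc : cone_below p S.
  split.
  - by exists 0; rewrite sc_of0 scale0r mul0r.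
  - move=> _ _ _ _ [r [r0 -> ->]] [s [s0 -> ->]]; exists (r + s).
    by rewrite addr_ge0// sc_ofD scalerDl mulrDl.
  - move=> r _ _ r0 [s [s0 -> ->]]; exists (r * s).
    by rewrite mulr_ge0// sc_ofM scalerA mulrA.
  - by move=> _ _ [r [r0 -> ->]]; rewrite ps.2 rn_sc_of.
have [G [Gl Gp GS]] := mazur_orlicz psl Sc.
have [F [Fl FG]] := real_linear_complexify Gl.
have Fp := rn_le_seminorm ps Fl (fun y => eq_ind_r (fun t => t <= p y) (Gp y) (FG y)).
exists F; split=> //.
have px : p x <= sc_re (F x).
  by rewrite FG; apply: GS; exists 1; rewrite sc_of1 scale1r mul1r.
exact: rn_le_re (Fp x) px.
Qed.

(** The requirements imposed on [G] are [sc_re (F z) - p z <= sc_re (G z)]; they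
    are consistent with [G <= q] because of the bound on [F]. *)
Lemma hahn_banach_split p q (F : V -> K^o) : seminorm p -> seminorm q ->
  linear F -> (forall x, rn (F x) <= p x + q x) ->
  exists G : V -> K^o, [/\ linear G, forall x, rn (G x) <= q x &
    forall x, rn (F x - G x) <= p x].
Proof.
move=> ps qs Fl Fpq.
have F0 : F 0 = 0 by have := Fl (-1) 0 0; rewrite scaler0 addr0 scaleN1r addNr.
have FD x y : F (x + y) = F x + F y by have := Fl 1 x y; rewrite !scale1r.
have FZ a x : F (a *: x) = a * F x by have := Fl a x 0; rewrite F0 !addr0.
pose S z b := b <= sc_re (F z) - p z.
have Sc : cone_below q S.
  split.
  - by rewrite /S F0 sc_re0 (sublinear0 (seminorm_sublinear ps)) subr0.
  - move=> z b z' b'; rewrite /S FD sc_reD; have := ps.1 z z'; lra.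
  - move=> r z b r0; rewrite /S FZ sc_re_ofM ps.2 rn_sc_of// -mulrBr.
    exact: ler_wpM2l.
  - move=> z b; rewrite /S; have := Fpq z; have := sc_re_le (F z); lra.
have [G [Gl Gq GS]] := mazur_orlicz (seminorm_sublinear qs) Sc.
have [H [Hl HG]] := real_linear_complexify Gl.
exists H; split=> //.
  by apply: rn_le_seminorm => // x; rewrite HG.
apply: (@rn_le_seminorm p (fun x => F x - H x)) => //.
  move=> a x y; rewrite Fl Hl scalerBr; ring.
by move=> x; rewrite sc_reB HG; have := GS x _ (lexx _); lra.
Qed.

End hahn_banach.

(** * Dual spaces and Helly's theorem *)

Section dual_facts.
Context {R : realType} {k : scalar_kind}.
Local Notation K := (scalars R k).
Variable V : normedModType K.
Implicit Types (f g : dual V) (x y : V).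

Lemma rn_dual_le f x : rn (f x) <= rn f * rn x.
Proof. by rewrite -(@ler_sc_of R k) sc_ofM !rnK; exact: le_dual_norm. Qed.

Lemma rn_dual_ge f (M : R) : 0 <= M -> (forall x, rn (f x) <= M * rn x) ->
  rn f <= M.
Proof.
move=> M0 fM; rewrite -(@ler_sc_of R k) rnK; apply: dual_norm_le.
  by rewrite sc_of_ge0.
by move=> x; rewrite -!rnK -sc_ofM ler_sc_of.
Qed.

Lemma rn_dual_le1 f x (M : R) : rn f <= M -> rn x <= 1 -> rn (f x) <= M.
Proof.
move=> fM x1; apply: le_trans (rn_dual_le _ _) _; apply: le_trans fM.
by rewrite -[leRHS]mulr1 ler_wpM2l ?rn_ge0.
Qed.

Lemma dual_of (F : V -> K^o) (M : R) : linear F -> 0 <= M ->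
  (forall x, rn (F x) <= M * rn x) -> exists f : dual V, forall x, f x = F x.
Proof.
move=> Fl M0 FM.
have Fd : F \in @dual_pred _ _ V.
  apply: (@bounded_dual_pred _ _ _ _ (sc_of M)); rewrite ?sc_of_ge0// => x.
  by rewrite -!rnK -sc_ofM ler_sc_of.
by exists (Dual Fd).
Qed.

Lemma rn_dual_adherent f (e : R) : 0 < e ->
  exists2 x, rn x <= 1 & rn f - e < sc_re (f x).
Proof.
move=> e0.
suff [x x1 fx] : exists2 x, rn x <= 1 & rn f - e < rn (f x).
  have [t t1 tf] := sc_phase (f x); exists (t *: x).
    by rewrite rnZ t1 mul1r.
  by rewrite linearZ /= [t *: _]tf sc_ofK.
have [fe|fe] := ltP (rn f - e) 0.
  by exists 0; rewrite ?rn0//; apply: lt_le_trans fe _; exact: rn_ge0.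
apply: contrapT => /forall2NP H.
suff : rn f <= rn f - e by lra.
apply: rn_dual_ge => // x.
have [->|/eqP x0] := eqVneq x 0; first by rewrite linear0 !rn0 mulr0.
have nx := rn_gt0 x0.
have [] := H (sc_of (rn x)^-1 *: x).
  by rewrite rnZ rn_sc_of ?invr_ge0 ?rn_ge0// mulVf ?gt_eqF.
move/negP; rewrite -leNgt linearZ /= rnZ rn_sc_of ?invr_ge0 ?rn_ge0//.
by rewrite ler_pdivrMl// mulrC.
Qed.

Lemma dual_mapD f x y : f (x + y) = f x + f y.
Proof. exact: linearD. Qed.

Lemma dual_mapZ f (a : K) x : f (a *: x) = a * f x.
Proof. exact: linearZ. Qed.

Lemma dual_sumE (T : Type) (s : seq T) (F : T -> dual V) x :
  (\sum_(i <- s) F i) x = \sum_(i <- s) F i x.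
Proof. by elim: s => [|i s IH]; rewrite ?big_nil// !big_cons dualDE IH. Qed.

Lemma dualBE f g x : (f - g) x = f x - g x.
Proof. by []. Qed.

Lemma norming_functional x :
  exists f : dual V, rn f <= 1 /\ f x = sc_of (rn x).
Proof.
have sn : seminorm (fun y : V => rn y) by split; [exact: rnD|exact: rnZ].
have [F [Fl F1 Fx]] := hahn_banach_norming x sn.
have [f fF] : exists f : dual V, forall y, f y = F y.
  by apply: (@dual_of F 1) => // y; rewrite mul1r.
exists f; rewrite fF; split=> //.
by apply: rn_dual_ge => // y; rewrite mul1r fF.
Qed.

End dual_facts.

Section embedding_facts.
Context {R : realType} {k : scalar_kind}.
Local Notation K := (scalars R k).
Variable V : normedModType K.

Lemma bidual_embedding_linear : linear (@bidual_embedding R k V).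
Proof. by move=> a x y; apply: dualP => f /=; rewrite linearP. Qed.

Lemma rn_bidual_embedding (x : V) : rn (bidual_embedding x) = rn x.
Proof.
apply/le_anti; rewrite -rn_le bidual_embedding_le /=.
have [f [f1 fx]] := norming_functional x.
have := rn_dual_le (bidual_embedding x) f; rewrite /= fx rn_sc_of ?rn_ge0//.
by have := rn_ge0 (bidual_embedding x); have := rn_ge0 f; nra.
Qed.

Lemma rn_restriction (phi : dual (dual (dual V))) : rn (restriction phi) <= rn phi.
Proof.
apply: rn_dual_ge => [|x]; first exact: rn_ge0.
by have := rn_dual_le phi (bidual_embedding x); rewrite rn_bidual_embedding.
Qed.

Lemma restriction_linear : linear (@restriction R k V).
Proof. by move=> a x y; apply: dualP => f. Qed.

End embedding_facts.

Section helly.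
Context {R : realType} {k : scalar_kind}.
Local Notation K := (scalars R k).
Variables (E : normedModType K) (T : finType) (l : T -> dual E) (p : T -> K).

(** Helly's theorem. A near minimiser [u] of the Euclidean distance from
    [l u] to [p] over the unit ball nearly satisfies the variational inequality
    of a projection, and that inequality bounds the distance. *)
Lemma helly (d : R) : 0 < d ->
  (forall c : T -> K, rn (\sum_i c i * p i) <= rn (\sum_i c i *: l i)) ->
  exists2 u, rn u <= 1 & forall i, rn (l i u - p i) <= d.
Proof.
move=> d0 hyp.
pose Phi u := \sum_i rn (p i - l i u) ^+ 2.
have Phi0 u : 0 <= Phi u by apply: sumr_ge0 => i _; exact: sqr_ge0.
pose A := [set Phi u | u in [set u | rn u <= 1]].
have A0 : A !=set0 by exists (Phi 0), 0 => //=; rewrite rn0.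
have lbA : has_lbound A by exists 0 => _ [u _ <-].
pose M := \sum_i (2 * rn (l i)) ^+ 2.
have M0 : 0 <= M by apply: sumr_ge0 => i _; exact: sqr_ge0.
pose t := d ^+ 2 / (d ^+ 2 + 3 + M).
have dM : 0 < d ^+ 2 + 3 + M by have := exprn_gt0 2 d0; lra.
have t0 : 0 < t by rewrite divr_gt0// exprn_gt0.
have t1 : t <= 1 by rewrite ler_pdivrMr// mul1r; lra.
have tM : t * (3 + M) <= d ^+ 2.
  rewrite /t mulrAC ler_pdivrMr//; have := exprn_gt0 2 d0; nra.
have [_ [u /= u1 <-] um] := inf_adherent (exprn_gt0 2 t0) (conj A0 lbA).
exists u => //.
pose w i := p i - l i u.
have [c cE] : exists c : T -> K, forall i z, sc_ip (w i) z = sc_re (c i * z).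
  by have /boolp.choice[c cE] := fun i => sc_ip_re (w i); exists c.
have var v : rn v <= 1 ->
    \sum_i sc_ip (w i) (l i v) <= \sum_i sc_ip (w i) (l i u) + t * (1 + M) / 2.
  move=> v1; pose y := u + sc_of t *: (v - u).
  have y1 : rn y <= 1.
    have -> : y = sc_of (1 - t) *: u + sc_of t *: v.
      by rewrite /y sc_ofB sc_of1 scalerBr scalerBl scale1r addrA addrAC.
    apply: le_trans (rnD _ _) _; rewrite !rnZ !rn_sc_of; [|lra..].
    by nra.
  have : inf A <= Phi y by apply: ge_inf => //; exists y.
  have -> : Phi y = Phi u - 2 * t * (\sum_i sc_ip (w i) (l i v) -
      \sum_i sc_ip (w i) (l i u)) + t ^+ 2 * \sum_i rn (l i (v - u)) ^+ 2.
    rewrite -sumrB /Phi !mulr_sumr -sumrB -big_split /=; apply: eq_bigr => i _.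
    have -> : p i - l i y = w i + sc_of (- t) * l i (v - u).
      by rewrite /w /y linearD linearZ /= sc_ofN mulNr opprD addrA.
    rewrite rn_sqrD_of.
    have -> : sc_ip (w i) (l i (v - u)) = sc_ip (w i) (l i v) - sc_ip (w i) (l i u).
      by rewrite linearB !cE mulrBr sc_reB.
    by ring.
  have : \sum_i rn (l i (v - u)) ^+ 2 <= M.
    apply: ler_sum => i _; rewrite ler_pXn2r ?nnegrE ?mulr_ge0 ?rn_ge0//.
    apply: le_trans (rn_dual_le _ _) _; rewrite mulrC ler_wpM2r ?rn_ge0//.
    by apply: le_trans (rnB _ _) _; lra.
  set Q := \sum_i rn _ ^+ 2.
  set D := \sum_i sc_ip (w i) (l i v) - _ => QM inA.
  have : t ^+ 2 * Q <= t ^+ 2 * M by rewrite ler_wpM2l ?sqr_ge0.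
  have -> : t ^+ 2 * M = t * (t * M) by ring.
  move=> tQ; have : t * (2 * D) <= t * (t * (1 + M)).
    by move: um inA tQ; lra.
  by rewrite ler_pM2l// /D; lra.
have [v v1 hv] := rn_dual_adherent (\sum_i c i *: l i) t0.
have h1 := var v v1; have h3 := hyp c.
have h2 : sc_re ((\sum_i c i *: l i) v) = \sum_i sc_ip (w i) (l i v).
  by rewrite dual_sumE sc_re_sum; apply: eq_bigr => i _; rewrite cE.
rewrite h2 in hv.
have h4 : \sum_i sc_ip (w i) (p i) <= rn (\sum_i c i * p i).
  apply: le_trans (sc_re_le _); rewrite sc_re_sum le_eqVlt; apply/orP; left.
  by apply/eqP; apply: eq_bigr => i _; rewrite cE.
have h5 : Phi u <= d ^+ 2.
  have -> : Phi u = \sum_i sc_ip (w i) (p i) - \sum_i sc_ip (w i) (l i u).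
    rewrite -sumrB; apply: eq_bigr => i _.
    by rewrite rn_sqr !cE -sc_reB -mulrBr -cE.
  by have := exprn_gt0 2 d0; lra.
move=> i; rewrite -(@ler_pXn2r _ 2)// ?nnegrE ?rn_ge0 ?(ltW d0)//.
apply: le_trans h5; rewrite rn_dist /Phi (bigD1 i)//= lerDl.
by apply: sumr_ge0 => j _; exact: sqr_ge0.
Qed.

End helly.

(** * Weak-star limits and dense subspaces *)

Section weak_star_limit.
Context {R : realType} {k : scalar_kind}.
Local Notation K := (scalars R k).
Variables (V : normedModType K) (g : nat -> dual V) (M : R).
Hypothesis gM : forall n, rn (g n) <= M.

(** A functional below [limsup Re (g n)] serves as a weak-star cluster point of
    the sequence: closed discs that eventually contain [g n x] contain its value
    at [x]. *)
Lemma weak_star_limit : exists phi : dual V, forall x z (r : R) n0,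
  (forall n, (n0 <= n)%N -> rn (g n x - z) <= r) -> rn (phi x - z) <= r.
Proof.
have M0 : 0 <= M := le_trans (rn_ge0 _) (gM 0).
pose A x := [set t : R | exists n0, forall n, (n0 <= n)%N -> sc_re (g n x) <= t].
pose p x := inf (A x).
have gx n x : rn (g n x) <= M * rn x.
  by apply: le_trans (rn_dual_le _ _) _; rewrite ler_wpM2r ?rn_ge0.
have AM x : A x (M * rn x).
  by exists 0 => n _; apply: le_trans (sc_re_le _) _.
have A0 x : A x !=set0 by exists (M * rn x).
have Alb x : lbound (A x) (- (M * rn x)).
  move=> t [n0 /(_ n0 (leqnn _))]; apply: le_trans.
  have := sc_re_le (- g n0 x); rewrite sc_reN rnN; have := gx n0 x; lra.
have ple x t : A x t -> p x <= t.
  by move=> At; apply: ge_inf => //; exists (- (M * rn x)).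
have ps : sublinear p.
  split=> [x y|r x].
    apply: le_infD => // s t [n hs] [m ht]; apply: ple; exists (maxn n m) => j.
    by rewrite geq_max linearD sc_reD => /andP[/hs ? /ht ?]; lra.
  rewrite le_eqVlt => /orP[/eqP<-|r0].
    rewrite sc_of0 scale0r mul0r; apply: ple; exists 0 => n _.
    by rewrite linear0 sc_re0.
  rewrite -ler_pdivrMl//; apply: lb_le_inf => // t [n ht].
  rewrite ler_pdivrMl//; apply: ple; exists n => m /ht.
  by rewrite linearZ /= [_ *: _]/(_ * _) sc_re_ofM ler_pM2l.
have [q [qs qp qmin]] := minimal_sublinear ps.
have [F [Fl Fq]] := real_linear_complexify (minimal_sublinear_linear qs qmin).
have Fp x : sc_re (F x) <= p x by rewrite Fq.
have FM : forall x, rn (F x) <= M * rn x.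
  apply: rn_le_seminorm => //; last by move=> x; apply: le_trans (Fp x) (ple _ _ _).
  split=> [x y|a x]; last by rewrite rnZ mulrCA.
  by rewrite -mulrDr ler_wpM2l ?rnD.
have [phi phiF] := dual_of Fl M0 FM.
exists phi => x z r n0 gr.
have [t t1 tz] := sc_phase (phi x - z).
rewrite -[leLHS](@sc_ofK R k) -tz mulrBr sc_reB lerBlDr.
have -> : t * phi x = phi (t *: x) by rewrite linearZ.
rewrite phiF; apply: le_trans (Fp _) _; apply: ple; exists n0 => n /gr gnr.
rewrite -lerBlDr -sc_reB; apply: le_trans (sc_re_le _) _.
by rewrite linearZ -mulrBr rnM t1 mul1r.
Qed.

End weak_star_limit.

Section density.
Context {R : realType} {k : scalar_kind}.
Local Notation K := (scalars R k).

Lemma closure_approx (V : normedModType K) (S : set V) (v : V) (e : R) :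
  0 < e -> closure S v -> exists2 s, S s & rn (v - s) <= e.
Proof.
move=> e0 /(_ (ball v (sc_of e : K))) [].
  by apply: nbhsx_ballx; rewrite -(@sc_of0 R k) ltr_sc_of.
move=> s [Ss]; rewrite -ball_normE /= => vs; exists s => //.
by rewrite -(@ler_sc_of R k) rnK ltW.
Qed.

Lemma approx_closure (V : normedModType K) (S : set V) (v : V) :
  (forall e : R, 0 < e -> exists2 s, S s & rn (v - s) <= e) -> closure S v.
Proof.
move=> H B /nbhs_ballP[e /= e0 eB].
have e2 : 0 < sc_re e / 2 by have := sc_re_gt0 e0; lra.
have [s Ss vs] := H _ e2; exists s; split=> //; apply: eB.
rewrite -ball_normE /= -rnK -[e]sc_reK ?(ltW e0)// ltr_sc_of.
by apply: le_lt_trans vs _; lra.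
Qed.

Variables (V : normedModType K) (S : set V).
Hypothesis SZ : forall a v, S v -> S (a *: v).
Hypothesis Sd : closure S = setT.

Lemma dense_norming (phi : dual V) (M : R) : 0 <= M -> M < rn phi ->
  exists y, [/\ S y, rn y <= 1 & M < rn (phi y)].
Proof.
move=> M0 Mphi; apply: contrapT => H.
have SM y : S y -> rn (phi y) <= M * rn y.
  move=> Sy; have [->|/eqP y0] := eqVneq y 0; first by rewrite linear0 !rn0 mulr0.
  have ny := rn_gt0 y0; rewrite leNgt; apply/negP => h; apply: H.
  exists (sc_of (rn y)^-1 *: y); split; first exact: SZ.
    by rewrite rnZ rn_sc_of ?invr_ge0 ?rn_ge0// mulVf ?gt_eqF.
  rewrite linearZ /= rnZ rn_sc_of ?invr_ge0 ?rn_ge0//.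
  by rewrite ltr_pdivlMl// mulrC.
suff : rn phi <= M by lra.
apply: rn_dual_ge => // x; apply/ler_addgt0Pr => e e0.
pose d := e / (M + rn phi + 1).
have N0 : 0 < M + rn phi + 1 by have := rn_ge0 phi; lra.
have d0 : 0 < d by rewrite divr_gt0.
have dE : d * (M + rn phi + 1) = e by rewrite /d divfK ?gt_eqF.
have [|y Sy xy] := @closure_approx _ S x d d0; first by rewrite Sd.
have h1 : rn (phi x) <= rn (phi y) + rn phi * d.
  have -> : phi x = phi y + phi (x - y) by rewrite linearB addrC subrK.
  apply: le_trans (rnD _ _) _; rewrite lerD2l.
  by apply: le_trans (rn_dual_le _ _) _; rewrite ler_wpM2l ?rn_ge0.
have h2 : rn y <= rn x + d.
  have -> : y = x - (x - y) by rewrite opprB addrC subrK.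
  by apply: le_trans (rnB _ _) _; rewrite lerD2l.
have := SM _ Sy; have : M * rn y <= M * (rn x + d) by rewrite ler_wpM2l.
lra.
Qed.

End density.

Lemma linear_spanZ (R : realType) (k : scalar_kind) (V : lmodType (scalars R k))
  (I : Type) (x : I -> V) a v : linear_span x v -> linear_span x (a *: v).
Proof.
move=> [s ->]; exists [seq (a * p.1, p.2) | p <- s].
by rewrite big_map scaler_sumr; apply: eq_bigr => p _; rewrite scalerA.
Qed.

(** * Fragmentation of the dual by the weak-star topology *)

Section fragmentation.
Context {R : realType} {k : scalar_kind}.
Local Notation K := (scalars R k).
Variables (X : normedModType K) (I : choiceType) (x : I -> X) (f : I -> dual X).
Hypothesis fx : forall i j, i <> j -> f i (x j) = 0.
Hypothesis x_dense : closure (linear_span x) = setT.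
Hypothesis f_dense : closure (linear_span f) = setT.

Definition supported_in (s : seq I) (y : X) := forall i, i \notin s -> f i y = 0.

Lemma linear_span_supported y : linear_span x y -> exists s, supported_in s y.
Proof.
move=> [s ->]; exists (map snd s) => i si; rewrite linear_sum /= big_seq big1//.
move=> [a j] js; rewrite linearZ /= fx ?scaler0// => ij.
by move: si; rewrite ij; apply/negP/negPn; apply/mapP; exists (a, j).
Qed.

(** Names for a countable dense set of combinations of the functionals [f i]
    with [i] in a list [J]: an index is named by its position in [J], so that
    names keep their meaning when [J] is extended on the right. *)
Local Notation code := (seq (nat * nat)%type).

Definition decode (d : nat -> K) (J : seq I) (c : code) : dual X :=
  \sum_(p <- c) d p.2 *: nth 0 (map f J) p.1.

(** Each code recurs infinitely often, hence also after the list of indices has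
    grown to contain those that the code names. *)
Definition challenge (n : nat) : code :=
  (odflt (0%N, [::]) (unpickle n : option (nat * code))).2.

Lemma challenge_surj (c : code) (n0 : nat) : exists2 n, (n0 <= n)%N & challenge n = c.
Proof.
suff [m nm] : exists m : nat, (n0 <= pickle (m, c))%N.
  by exists (pickle (m, c)) => //; rewrite /challenge pickleK.
apply: contrapT => /forallNP H.
have lt (i : 'I_n0.+1) : (pickle (i : nat, c) < n0)%N.
  by rewrite ltnNge; apply/negP; exact: H.
have : injective (fun i : 'I_n0.+1 => Ordinal (lt i)).
  move=> i j /(congr1 val) /= /(pcan_inj pickleK) [ij]; exact: val_inj.
by move=> /(@leq_card _ _) ; rewrite !card_ord ltnn.
Qed.

Section game.
Variables (A : set (dual X)) (M e : R) (d : nat -> K).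
Hypothesis AM : forall g, A g -> rn g <= M.
Hypothesis e0 : 0 < e.
Hypothesis d_dense : forall z (r : R), 0 < r -> exists n, rn (z - d n) <= r.
Hypothesis no_small : forall g (L : seq X) (r : R), A g -> 0 < r ->
  exists g', [/\ A g', forall y, y \in L -> rn (g' y - g y) <= r & 8 * e < rn (g' - g)].

(** Of two points of [A] at distance more than [8 * e], one is at distance more
    than [4 * e] from [h]. *)
Lemma game_move (g h : dual X) (L : seq X) (r : R) : A g -> 0 < r ->
  exists g' y s, [/\ A g', forall z, z \in L -> rn (g' z - g z) <= r,
    supported_in s y, rn y <= 1 & 4 * e < rn (g' y - h y)].
Proof.
move=> Ag r0.
have [g' [Ag' g'L g'h]] : exists g', [/\ A g',
    forall y, y \in L -> rn (g' y - g y) <= r & 4 * e < rn (g' - h)].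
  have [gh|gh] := ltVle (4 * e) (rn (g - h)).
    by exists g; split=> // y _; rewrite subrr rn0 ltW.
  have [g' [Ag' g'L g'g]] := no_small L Ag r0; exists g'; split=> //.
  have -> : g' - h = (g' - g) - (h - g) by rewrite opprB addrA subrK.
  have : rn (g' - g) <= rn ((g' - g) - (h - g)) + rn (h - g).
    by rewrite -[X in rn X <= _](subrK (h - g)) rnD.
  have : rn (h - g) = rn (g - h) by exact: rn_dist.
  by rlra.
have e4 : 0 <= 4 * e by rewrite mulr_ge0// ltW.
have [y [/linear_span_supported[s sy] y1 gy]] :=
  dense_norming (@linear_spanZ _ _ _ _ x) x_dense e4 g'h.
by exists g', y, s.
Qed.

(** A position of the game: the current functional, the vectors tested so far
    and a list of indices that supports them. *)
Let state := (dual X * seq X * seq I)%type.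

Let legal (n : nat) (st st' : state) := A st.1.1 ->
  [/\ A st'.1.1, forall z, z \in st.1.2 -> rn (st'.1.1 z - st.1.1 z) <= e * 2^-1 ^+ n.+1 &
    exists y s, [/\ st'.1.2 = y :: st.1.2, st'.2 = st.2 ++ s, supported_in s y,
      rn y <= 1 & 4 * e < rn (st'.1.1 y - decode d st.2 (challenge n) y)]].

Lemma legal_move (a : nat * state) : exists st', legal a.1 a.2 st'.
Proof.
case: a => n [[g L] J] /=; have [Ag|nA] := pselect (A g); last by exists (g, L, J).
have r0 : 0 < e * 2^-1 ^+ n.+1 by rewrite mulr_gt0// exprn_gt0// invr_gt0.
have [g' [y [s [Ag' gL sy y1 gy]]]] :=
  game_move (decode d J (challenge n)) L Ag r0.
by exists (g', y :: L, J ++ s) => _; split=> //; exists y, s.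
Qed.

(** The play of the game: functionals [g n] whose values at the earlier test
    vectors converge, [y n] being a witness that [g n.+1] is far from the [n]-th
    challenge. *)
Lemma play (g0 : dual X) : A g0 -> exists g y (J : nat -> seq I),
  [/\ forall n, A (g n),
      forall n m, (n < m)%N -> rn (g m (y n) - g n.+1 (y n)) <= e,
      forall n, exists s, J n.+1 = J n ++ s,
      forall n, rn (y n) <= 1 /\ supported_in (J n.+1) (y n)
    & forall n, 4 * e < rn (g n.+1 (y n) - decode d (J n) (challenge n) (y n))].
Proof.
move=> Ag0; have /boolp.choice[next nextP] := legal_move.
pose st := nat_rect (fun=> state) (g0, [::], [::]) (fun n s => next (n, s)).
have stA n : A (st n).1.1.
  by elim: n => //= n IH; have [] := nextP (n, st n) IH.
have stP n := nextP (n, st n) (stA n).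
have /boolp.choice[y yP] n : exists y, exists s, [/\ (st n.+1).1.2 = y :: (st n).1.2,
    (st n.+1).2 = (st n).2 ++ s, supported_in s y, rn y <= 1 &
    4 * e < rn ((st n.+1).1.1 y - decode d (st n).2 (challenge n) y)].
  by have [_ _ [y [s P]]] := stP n; exists y, s.
have yL n j : y n \in (st (n.+1 + j)%N).1.2.
  elim: j => [|j IH]; first by have [s [yE _ _ _ _]] := yP n; rewrite addn0 yE mem_head.
  by have [s [yE _ _ _ _]] := yP (n.+1 + j)%N; rewrite addnS yE inE IH orbT.
exists (fun n => (st n).1.1), y, (fun n => (st n).2); split=> //.
- move=> n m nm; rewrite -(subnKC nm); move: (m - n.+1)%N => j {m nm}.
  suff : rn ((st (n.+1 + j)%N).1.1 (y n) - (st n.+1).1.1 (y n)) <=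
         e * (2^-1 ^+ n.+1 - 2^-1 ^+ (n.+1 + j)).
    move=> h; apply: le_trans h _; rewrite -[leRHS]mulr1 ler_pM2l//.
    have : 2^-1 ^+ n.+1 <= 1 :> R.
      by apply: exprn_ile1; rewrite ?invr_ge0// invf_le1// ler1n.
    have : 0 <= 2^-1 ^+ (n.+1 + j) :> R by rewrite exprn_ge0// invr_ge0.
    lra.
  elim: j => [|j IH]; first by rewrite addn0 !subrr rn0 mulr0.
  have [_ /(_ _ (yL n j)) h _] := stP (n.+1 + j)%N.
  have {}h : rn ((st (n.+1 + j.+1)%N).1.1 (y n) - (st (n.+1 + j)%N).1.1 (y n)) <=
    e * (2^-1 * 2^-1 ^+ (n.+1 + j)) by rewrite -exprS addnS; exact: h.
  have := rn_triangle ((st (n.+1 + j.+1)%N).1.1 (y n))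
    ((st (n.+1 + j)%N).1.1 (y n)) ((st n.+1).1.1 (y n)).
  move/le_trans; apply; apply: le_trans (lerD h IH) _.
  rewrite addnS [_ ^+ (n.+1 + j).+1]exprS -mulrDr ler_pM2l//.
  by move: (_ ^+ (n.+1 + j)) (_ ^+ n.+1) => t s; lra.
- by move=> n; have [s [_ -> _ _ _]] := yP n; exists s.
- move=> n; have [s [_ -> sy y1 _]] := yP n; split=> // i.
  by rewrite mem_cat negb_or => /andP[_ /sy].
- by move=> n; have [s [_ _ _ _ h]] := yP n.
Qed.

(** The functionals [g n] have a weak-star cluster point [phi], and [phi] is
    close to a combination [h] of the [f i]. On the test vectors, which are
    supported in the lists [J n], the terms of [h] with index outside these lists
    vanish, so [h] is close to the functional of some code. This code is a
    challenge at some late stage [n], where the vector [y n] keeps [g n.+1], and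
    with it [phi], away from it. *)
Lemma game_absurd g0 : A g0 -> False.
Proof.
move=> /play[g [y [J [gA gy JS yP ych]]]].
have Jmono n m : (n <= m)%N -> exists s, J m = J n ++ s.
  move=> nm; rewrite -(subnKC nm); elim: (m - n)%N => [|j [s IH]].
    by exists [::]; rewrite addn0 cats0.
  by have [s' JE] := JS (n + j)%N; exists (s ++ s'); rewrite addnS JE IH catA.
pose Y z := rn z <= 1 /\ forall i, (forall n, i \notin J n) -> f i z = 0.
have codes (s : seq (K * I)) : forall r : R, 0 < r -> exists c n0, forall n z,
    (n0 <= n)%N -> Y z ->
    rn ((\sum_(p <- s) p.1 *: f p.2) z - decode d (J n) c z) <= r.
  elim: s => [r r0|[a i] s IH r r0].
    by exists [::], 0%N => n z _ _; rewrite /decode !big_nil subrr rn0 ltW.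
  have r20 : 0 < r / 2 by lra.
  have [c [n0 cP]] := IH _ r20.
  have [[m im]|/forallNP iJ] := pselect (exists m, i \in J m); last first.
    exists c, n0 => n z nn zY; rewrite big_cons dualDE dualZE /= zY.2.
      by rewrite mulr0 add0r; apply: le_trans (cP _ _ nn zY) _; lra.
    by move=> j; apply/negP; exact: iJ.
  have fi0 : 0 < rn (f i) + 1 by have := rn_ge0 (f i); lra.
  have [l dl] := d_dense a (divr_gt0 r20 fi0).
  exists ((index i (J m), l) :: c), (maxn m n0) => n z.
  rewrite geq_max => /andP[mn nn] zY.
  have -> : decode d (J n) ((index i (J m), l) :: c) = d l *: f i + decode d (J n) c.
    rewrite /decode big_cons /=; congr (_ *: _ + _).
    have [s' ->] := Jmono _ _ mn.
    have im' : (index i (J m) < size (J m))%N by rewrite index_mem.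
    by rewrite (nth_map i) ?nth_cat ?im' ?nth_index// size_cat (leq_trans im')// leq_addr.
  rewrite big_cons !dualDE !dualZE /= opprD addrACA -mulrBl.
  apply: le_trans (rnD _ _) _; have := cP _ _ nn zY.
  suff : rn ((a - d l) * f i z) <= r / 2 by lra.
  rewrite rnM; have h1 : rn (f i z) <= rn (f i) + 1.
    by have := rn_dual_le1 (lexx (rn (f i))) zY.1; lra.
  move: dl; rewrite ler_pdivlMr// => dl.
  apply: le_trans dl; by rewrite ler_wpM2l ?rn_ge0.
have [phi phiP] := weak_star_limit (fun n => AM (gA n)).
have [|h [s hE] hs] := @closure_approx _ _ _ (linear_span f) phi e e0.
  by rewrite f_dense.
have [c [n0 cP]] := codes s e e0.
have [n nn cn] := challenge_surj c n0.
have yY : Y (y n).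
  by split=> [|i iJ]; [exact: (yP n).1|exact: (yP n).2].
have h1 := ych n; rewrite cn in h1.
have h2 := cP _ _ nn yY; rewrite -hE in h2.
have h3 := phiP (y n) (g n.+1 (y n)) e n.+1 (fun m nm => gy n m nm).
have h4 := rn_dual_le1 hs yY.1; rewrite dualBE in h4.
move: h1 h2 h3 h4; move: (g n.+1 (y n)) (decode _ _ _ _) (h (y n)) (phi (y n)).
move=> u v t w h1 h2 h3 h4.
have := rn_triangle u w v; have := rn_triangle w t v; rewrite (rn_dist u w).
move=> a1 a2.
have := lt_le_trans h1 (le_trans a2 (lerD h3 (le_trans a1 (lerD h4 h2)))).
by move: (e) e0 => r r0; lra.
Qed.

End game.

(** If no weak-star open piece of [A] were small, the game could be played, and
    [game_absurd] would apply. *)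
Lemma weak_star_fragmented (A : set (dual X)) (M e : R) : A !=set0 -> 0 < e ->
  (forall g, A g -> rn g <= M) ->
  exists g (L : seq X) r, [/\ A g, 0 < r &
    forall g', A g' -> (forall y, y \in L -> rn (g' y - g y) <= r) -> rn (g' - g) <= e].
Proof.
move=> [g0 Ag0] e0 AM; apply: contrapT => H; have [d dd] := @sc_dense R k.
have e8 : 0 < e / 8 by lra.
apply: (@game_absurd A M (e / 8) d AM e8 dd _ g0 Ag0) => g L r Ag r0.
apply: contrapT => H'; apply: H; exists g, L, r; split=> // g' Ag' g'L.
rewrite leNgt; apply/negP => h; apply: H'; exists g'; split=> //; lra.
Qed.

End fragmentation.

(** * Strict ideals in the bidual are canonical *)

Section strict_ideals.
Context {R : realType} {k : scalar_kind}.
Local Notation K := (scalars R k).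
Variables (X : normedModType K) (P : dual (dual (dual X)) -> dual (dual (dual X))).
Hypothesis P_ideal : ideal_projection (range (@bidual_embedding R k X)) P.
Hypothesis P_norming : norming (range P).

Let PP : linear P := let: And4 h _ _ _ := P_ideal in h.

Lemma ideal_projection_restriction phi : P phi = P (bidual_embedding (restriction phi)).
Proof.
have [_ _ _ Pker] := P_ideal.
have PB u v : P (u - v) = P u - P v.
  by rewrite addrC -scaleN1r PP scaleN1r addrC.
suff : annihilator (range (@bidual_embedding R k X))
    (phi - bidual_embedding (restriction phi)).
  by rewrite -Pker /= PB => /eqP; rewrite subr_eq0 => /eqP.
by move=> _ [y _ <-]; rewrite dualBE /= subrr.
Qed.

(** The transpose of [P] on the bidual: by [ideal_projection_restriction] the
    range of [P] consists of the images of [X^*], so that being norming means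
    that this operator is isometric. *)
Lemma ideal_projection_transpose :
  exists S : dual (dual X) -> dual (dual X),
    (forall F f, S F f = P (bidual_embedding f) F) /\ forall F, rn (S F) = rn F.
Proof.
have [_ Pidem Pcontr _] := P_ideal.
have PB f F : rn (P (bidual_embedding f) F) <= rn F * rn f.
  apply: le_trans (rn_dual_le _ _) _; rewrite mulrC ler_wpM2l ?rn_ge0//.
  by have := Pcontr (bidual_embedding f); rewrite rn_le rn_bidual_embedding.
have /boolp.choice[S SE] F : exists SF : dual (dual X),
    forall f, SF f = P (bidual_embedding f) F.
  apply: (@dual_of _ _ (dual X) (fun f => P (bidual_embedding f) F) (rn F)).
  - by move=> a f g; rewrite bidual_embedding_linear PP.
  - exact: rn_ge0.
  - by move=> f; exact: PB.
exists S; split=> // F; apply/le_anti/andP; split.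
  by apply: rn_dual_ge (rn_ge0 _) _ => f; rewrite SE; exact: PB.
rewrite -rn_le P_norming; apply: ge_sc_sup.
  exists `|P 0 F|, (P 0) => //; split; first by exists 0.
  by apply: le_trans (Pcontr _) _; rewrite normr0.
move=> _ [u [[phi _ uE] /= u1] <-]; rewrite normr_ge0 /=.
rewrite -uE -Pidem uE ideal_projection_restriction -SE rn_le.
apply: rn_dual_le1 => //; apply: le_trans (rn_restriction _) _.
by rewrite -(@ler_sc_of R k) rnK sc_of1.
Qed.

Variables (I : choiceType) (x : I -> X) (f : I -> dual X).
Hypothesis fx : forall i j, i <> j -> f i (x j) = 0.
Hypothesis x_dense : closure (linear_span x) = setT.
Hypothesis f_dense : closure (linear_span f) = setT.

Section transpose.
Variable S : dual (dual X) -> dual (dual X).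
Hypothesis SE : forall F f, S F f = P (bidual_embedding f) F.
Hypothesis Sn : forall F, rn (S F) = rn F.

Lemma transpose_sum (T : finType) (c : T -> K) (F : T -> dual (dual X)) :
  S (\sum_t c t *: F t) = \sum_t c t *: S (F t).
Proof.
apply: dualP => g; rewrite SE linear_sum dual_sumE; apply: eq_bigr => t _.
by rewrite linearZ dualZE SE.
Qed.

Lemma transpose_embedding y : S (bidual_embedding y) = bidual_embedding y.
Proof.
apply: dualP => g; rewrite SE /=; have [_ Pidem _ Pker] := P_ideal.
have PB u v : P (u - v) = P u - P v.
  by rewrite addrC -scaleN1r PP scaleN1r addrC.
have : annihilator (range (@bidual_embedding R k X))
    (P (bidual_embedding g) - bidual_embedding g).
  by rewrite -Pker /= PB Pidem subrr.
move=> /(_ (bidual_embedding y)); rewrite dualBE => /(_ _)/eqP.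
by rewrite subr_eq0 => /(_ _)/eqP -> //; exists y.
Qed.

(** As [S] is isometric and commutes with linear combinations, the values of [g]
    at vectors [F t] satisfy the hypothesis of [helly] for the functionals
    [S (F t)], and conversely. Together the two lemmas say that images under [P]
    of the unit ball of [X^*] are weak-star dense in that of [X^***], where the
    unit ball of [X^*] itself is dense as well. *)
Lemma transpose_dense g (T : finType) (F : T -> dual (dual X)) (d : R) :
  rn g <= 1 -> 0 < d ->
  exists2 h, rn h <= 1 & forall t, rn (S (F t) h - F t g) <= d.
Proof.
move=> g1 d0; apply: (@helly R k _ _ (S \o F)) => // c /=.
rewrite -transpose_sum Sn; apply: le_trans (rn_dual_le1 (lexx _) g1).
by rewrite dual_sumE.
Qed.

Lemma dense_transpose g (T : finType) (F : T -> dual (dual X)) (d : R) :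
  rn g <= 1 -> 0 < d ->
  exists2 h, rn h <= 1 & forall t, rn (F t h - S (F t) g) <= d.
Proof.
move=> g1 d0; apply: helly => // c; rewrite -[leRHS]Sn transpose_sum.
by apply: le_trans (rn_dual_le1 (lexx _) g1); rewrite dual_sumE.
Qed.

(** In the slice [W] of the unit ball some point [g] has a small weak-star
    neighbourhood. Choose [h] in the ball of [X^*] with [P h] close to [g] at the
    vectors that define [W] and this neighbourhood. Then [P h] is a weak-star
    limit of points of the neighbourhood, so it is close to [g] in norm; by
    restriction to [X], so is [h]. Hence [P g] is close to [g], that is,
    [S F0 - F0] is small at [g], and its value at [f0] is almost the same. *)
Lemma transpose_near_id (F0 : dual (dual X)) f0 (e : R) : rn f0 <= 1 -> 0 < e ->
  rn ((S F0 - F0) f0) <= e * (2 * rn F0 + 1).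
Proof.
move=> f01 e0; set G := S F0 - F0.
pose W := [set g : dual X | rn g <= 1 /\ rn (G g - G f0) < e].
have W0 : W !=set0 by exists f0; split=> //; rewrite subrr rn0.
have WM g : W g -> rn g <= 1 by case.
have [g [L [r [[g1 gW] r0 small]]]] :=
  weak_star_fragmented fx x_dense f_dense W0 e0 WM.
have [d [d0 dr de]] : exists d : R,
    [/\ 0 < d, d + d <= r & d + d < e - rn (G g - G f0)].
  pose d0 := Num.min r (e - rn (G g - G f0)); exists (d0 / 3).
  have : 0 < d0 by rewrite lt_min r0 subr_gt0.
  have : d0 <= r by rewrite ge_min lexx.
  have : d0 <= e - rn (G g - G f0) by rewrite ge_min lexx orbT.
  by move: (_ - rn _) (d0) => t s *; split; lra.
pose l (t : option 'I_(size L)) : dual (dual X) :=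
  if t is Some i then bidual_embedding (tnth (in_tuple L) i) else G.
have [h h1 hP] := transpose_dense l g1 d0.
(* weak-star neighbours of [P h] in the ball of [X^*] lie in the small set *)
have near (F : dual (dual X)) : rn (F g - S F h) <= e * rn F.
  apply/ler_addgt0Pr => d' d'0.
  have m0 : 0 < Num.min d d' by rewrite lt_min d0.
  pose l' (t : option (option 'I_(size L))) := if t is Some s then l s else F.
  have [u u1 uP] := dense_transpose l' h1 m0.
  have ul (t : option 'I_(size L)) : rn (l t u - l t g) <= d + d.
    apply: le_trans (rn_triangle _ (S (l t) h) _) _; apply: lerD => //.
    by apply: le_trans (uP (Some t)) _; rewrite ge_min lexx.
  have uW : W u.
    split=> //; apply: le_lt_trans (rn_triangle _ (G g) _) _.
    by rewrite -ltrBrDr; apply: le_lt_trans (ul None) de.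
  have ug : rn (u - g) <= e.
    apply: small => // y /(tnthP (in_tuple L))[i ->].
    by apply: le_trans dr; exact: (ul (Some i)).
  apply: le_trans (rn_triangle _ (F u) _) _; apply: lerD.
    rewrite -linearB; apply: le_trans (rn_dual_le _ _) _.
    by rewrite mulrC ler_wpM2r ?rn_ge0// rn_dist.
  by apply: le_trans (uP None) _; rewrite ge_min lexx orbT.
have gh : rn (g - h) <= e.
  apply: rn_dual_ge (ltW e0) _ => y.
  by have := near (bidual_embedding y); rewrite transpose_embedding rn_bidual_embedding.
have Gg : rn (G g) <= e * rn F0 + e * rn F0.
  have -> : G g = S F0 (g - h) + (S F0 h - F0 g).
    by rewrite linearB /G dualBE addrA subrK.
  apply: le_trans (rnD _ _) _; apply: lerD; last by rewrite rn_dist.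
  by apply: le_trans (rn_dual_le _ _) _; rewrite Sn mulrC ler_wpM2r ?rn_ge0.
have -> : e * (2 * rn F0 + 1) = e + (e * rn F0 + e * rn F0) by ring.
have -> : G f0 = (G f0 - G g) + G g by rewrite subrK.
apply: le_trans (rnD _ _) _; apply: lerD => //.
by rewrite rn_dist ltW.
Qed.

End transpose.

Lemma ideal_projection_embedding f0 : P (bidual_embedding f0) = bidual_embedding f0.
Proof.
have [S [SE Sn]] := ideal_projection_transpose.
have ball g : rn g <= 1 -> P (bidual_embedding g) = bidual_embedding g.
  move=> g1; apply: dualP => F /=; rewrite -SE; apply/eqP; rewrite -subr_eq0.
  apply/eqP/rn_le0; apply/ler_addgt0Pr => e e0; rewrite add0r.
  have N0 : 0 < 2 * rn F + 1 by have := rn_ge0 F; rlra.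
  have := transpose_near_id SE Sn F g1 (divr_gt0 e0 N0).
  by rewrite divfK ?gt_eqF.
have [->|/eqP n0] := eqVneq f0 0; first by apply: ball; rewrite rn0.
have nf := rn_gt0 n0.
have eZ (a : K) g :
    bidual_embedding (a *: g) = a *: bidual_embedding g :> dual (dual (dual X)).
  by apply: dualP => F /=; rewrite linearZ.
have PZ a u : P (a *: u) = a *: P u.
  have P0 : P 0 = 0 by have := PP (-1) 0 0; rewrite scaler0 addr0 scaleN1r addNr.
  by have := PP a u 0; rewrite !addr0 P0 addr0.
have nK : sc_of (rn f0) * sc_of (rn f0)^-1 = 1 :> K.
  by rewrite -sc_ofM mulfV ?gt_eqF// sc_of1.
rewrite -[f0]scale1r -nK -scalerA eZ PZ ball//.
by rewrite rnZ rn_sc_of ?invr_ge0 ?rn_ge0// mulVf ?gt_eqF.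
Qed.

Lemma ideal_projection_natural phi : P phi = natural_projection phi.
Proof.
by rewrite ideal_projection_restriction ideal_projection_embedding.
Qed.

End strict_ideals.

(** * A strictly convex norm on the dual *)

Section day_norm.
Context {R : realType} {k : scalar_kind}.
Local Notation K := (scalars R k).
Variables (X : normedModType K) (I : choiceType) (x : I -> X) (f : I -> dual X).
Hypothesis fx1 : forall i, f i (x i) = 1.
Hypothesis fx : forall i j, i <> j -> f i (x j) = 0.
Hypothesis x1 : forall i, rn (x i) <= 1.
Hypothesis x_dense : closure (linear_span x) = setT.
Hypothesis f_dense : closure (linear_span f) = setT.
Implicit Types (g h : dual X) (A s : seq I).

Lemma biorthogonalE i j : f i (x j) = (i == j)%:R.
Proof. by case: eqP => [->|/fx]. Qed.

Lemma coord_inj g h : (forall i, g (x i) = h (x i)) -> g = h.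
Proof.
move=> gh; apply/eqP; rewrite -subr_eq0; apply/eqP/rn_le0.
case: (ltVle 0 (rn (g - h))) => // gh0.
have [y [[s ->] _]] := dense_norming (@linear_spanZ _ _ _ _ x) x_dense (lexx 0) gh0.
rewrite linear_sum big1 => [|p _]; first by rewrite rn0 ltxx.
have E : (g - h) (x p.2) = 0 by rewrite dualBE gh subrr.
by rewrite linearZ; exact: etrans (congr1 ( *%R p.1) E) (mulr0 _).
Qed.

Lemma rn_coord g i : rn (g (x i)) <= rn g.
Proof. by apply: rn_dual_le1. Qed.

(** The coordinates of a functional form an element of [c_0(I)]. *)
Lemma coord_c0 g (d : R) : 0 < d ->
  exists s, forall i, i \notin s -> rn (g (x i)) <= d.
Proof.
move=> d0; have [|_ [s ->] gs] := @closure_approx _ _ _ (linear_span f) g d d0.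
  by rewrite f_dense.
exists (map snd s) => i si.
have /eqP hi : (\sum_(p <- s) p.1 *: f p.2) (x i) == 0.
  rewrite dual_sumE big_seq big1// => -[a j] js; rewrite dualZE biorthogonalE.
  case: eqP => [ji|_]; last by rewrite mulr0.
  by move: si; rewrite -ji; case/negP; apply/mapP; exists (a, j).
by have := rn_dual_le1 gs (x1 i); rewrite dualBE hi subr0.
Qed.

Definition coord_sqr A g : R := \sum_(i <- A) rn (g (x i)) ^+ 2.

Definition selection (n : nat) : set (seq I) := [set A | uniq A /\ (size A <= n)%N].

(** The Euclidean norm of the [n] largest coordinates. *)
Definition top_norm (n : nat) g : R :=
  Num.sqrt (sup [set coord_sqr A g | A in selection n]).

Lemma coord_sqr_ge0 A g : 0 <= coord_sqr A g.
Proof. by apply: sumr_ge0 => i _; exact: sqr_ge0. Qed.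

Lemma coord_sqr_le A g (m : R) : (forall i, rn (g (x i)) <= m) ->
  coord_sqr A g <= (size A)%:R * m ^+ 2.
Proof.
move=> gm; rewrite mulr_natl -sum1_size /coord_sqr -sumrMnr.
elim: A => [|i A IH]; rewrite ?big_nil// !big_cons lerD//.
by rewrite ler_pXn2r ?nnegrE ?rn_ge0//; apply: le_trans (gm i); exact: rn_ge0.
Qed.

Lemma coord_sqr_le_n n A g (m : R) : (forall i, rn (g (x i)) <= m) -> 0 <= m ->
  selection n A -> coord_sqr A g <= (n.+1%:R * m) ^+ 2.
Proof.
move=> gm m0 [_ An]; apply: le_trans (coord_sqr_le A gm) _.
rewrite exprMn ler_wpM2r ?sqr_ge0//.
apply: (@le_trans _ _ n.+1%:R); first by rewrite ler_nat leqW.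
by rewrite expr2 -natrM ler_nat leq_pmulr.
Qed.

Lemma top_set_nonempty n g : [set coord_sqr A g | A in selection n] !=set0.
Proof. by exists (coord_sqr [::] g), [::]. Qed.

Lemma top_set_bounded n g : has_ubound [set coord_sqr A g | A in selection n].
Proof.
exists ((n.+1%:R * rn g) ^+ 2) => _ [A An <-].
by apply: coord_sqr_le_n => // [i|]; [exact: rn_coord|exact: rn_ge0].
Qed.

Lemma top_norm_ge0 n g : 0 <= top_norm n g.
Proof. exact: sqrtr_ge0. Qed.

Lemma top_norm_sqr n g :
  top_norm n g ^+ 2 = sup [set coord_sqr A g | A in selection n].
Proof.
rewrite sqr_sqrtr//; apply: le_trans (coord_sqr_ge0 [::] g) _.
by apply: ub_le_sup; [exact: top_set_bounded|exists [::]].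
Qed.

Lemma coord_sqr_top n A g : selection n A -> coord_sqr A g <= top_norm n g ^+ 2.
Proof.
by move=> An; rewrite top_norm_sqr; apply: ub_le_sup; [exact: top_set_bounded|exists A].
Qed.

Lemma top_norm_adherent n g (e : R) : 0 < e ->
  exists2 A, selection n A & top_norm n g ^+ 2 - e < coord_sqr A g.
Proof.
move=> e0; have [_ [A An <-]] := sup_adherent e0
  (conj (top_set_nonempty n g) (top_set_bounded n g)).
by rewrite -top_norm_sqr; exists A.
Qed.

Lemma top_norm_le n g (b : R) : 0 <= b ->
  (forall A, selection n A -> coord_sqr A g <= b ^+ 2) -> top_norm n g <= b.
Proof.
move=> b0 H; rewrite -(@ler_pXn2r _ 2)// ?nnegrE ?top_norm_ge0//.
rewrite top_norm_sqr; apply: ge_sup; first exact: top_set_nonempty.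
by move=> _ [A An <-]; exact: H.
Qed.

Lemma rn_coord_top n i g : rn (g (x i)) <= top_norm n.+1 g.
Proof.
rewrite -(@ler_pXn2r _ 2)// ?nnegrE ?top_norm_ge0 ?rn_ge0//.
have := @coord_sqr_top n.+1 [:: i] g; rewrite /coord_sqr big_seq1; exact.
Qed.

(** The sum over [A] of the identity [rn_sqrD_weighted]. *)
Lemma coord_sqrD (a b : R) A g h :
  a * b * coord_sqr A (g + h) +
    \sum_(i <- A) rn (sc_of b * g (x i) - sc_of a * h (x i)) ^+ 2 =
  (a + b) * (b * coord_sqr A g + a * coord_sqr A h).
Proof.
rewrite /coord_sqr !mulr_sumr -!big_split mulr_sumr /=; apply: eq_bigr => i _.
exact: rn_sqrD_weighted.
Qed.

Lemma coord_sqr_congr A g h : (forall i, i \in A -> g (x i) = h (x i)) ->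
  coord_sqr A g = coord_sqr A h.
Proof. by move=> gh; apply: eq_big_seq => i /gh ->. Qed.

Lemma coord_sqr_le0 A g i : coord_sqr A g <= 0 -> i \in A -> g (x i) = 0.
Proof.
move=> A0 iA; apply: rn_eq0; apply/eqP; rewrite -sqrf_eq0 eq_le sqr_ge0 andbT.
apply: le_trans A0; rewrite /coord_sqr (big_rem i)//= lerDl.
by apply: sumr_ge0 => j _; exact: sqr_ge0.
Qed.

Lemma top_normD n g h : top_norm n (g + h) <= top_norm n g + top_norm n h.
Proof.
have := top_norm_ge0 n g; have := top_norm_ge0 n h.
set a := top_norm n g; set b := top_norm n h => b0 a0.
apply: top_norm_le => [|A An]; first exact: addr_ge0.
have hb := coord_sqr_top h An; have ga := coord_sqr_top g An.
rewrite -/a -/b in ga hb.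
move: a0; rewrite le_eqVlt => /orP[/eqP a0|a0].
  rewrite -a0 add0r (@coord_sqr_congr _ _ h)// => i iA.
  by rewrite dualDE (@coord_sqr_le0 A g) ?add0r// (le_trans ga)// -a0 expr0n.
move: b0; rewrite le_eqVlt => /orP[/eqP b0|b0].
  rewrite -b0 addr0 (@coord_sqr_congr _ _ g)// => i iA.
  by rewrite dualDE (@coord_sqr_le0 A h) ?addr0// (le_trans hb)// -b0 expr0n.
have ab : 0 < a * b by rewrite mulr_gt0.
rewrite -(ler_pM2l ab).
have := coord_sqrD a b A g h; set D := \sum_(i <- A) _ => E.
have D0 : 0 <= D by apply: sumr_ge0 => i _; exact: sqr_ge0.
have : (a + b) * (b * coord_sqr A g + a * coord_sqr A h) <=
       (a + b) * (b * a ^+ 2 + a * b ^+ 2).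
  apply: ler_wpM2l; first by rewrite addr_ge0// ltW.
  by apply: lerD; apply: ler_wpM2l => //; exact: ltW.
have -> : (a + b) * (b * a ^+ 2 + a * b ^+ 2) = a * b * (a + b) ^+ 2 by ring.
rewrite -E; apply: le_trans; by rewrite lerDl.
Qed.

Lemma top_normZ_le n a g : top_norm n (a *: g) <= rn a * top_norm n g.
Proof.
apply: top_norm_le => [|A An]; first by rewrite mulr_ge0 ?rn_ge0 ?top_norm_ge0.
rewrite exprMn; apply: le_trans (ler_wpM2l (sqr_ge0 _) (coord_sqr_top g An)).
rewrite /coord_sqr mulr_sumr le_eqVlt; apply/orP; left; apply/eqP.
by apply: eq_bigr => i _; rewrite dualZE rnM exprMn.
Qed.

Lemma top_norm_bound n g (m : R) : (forall i, rn (g (x i)) <= m) -> 0 <= m ->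
  top_norm n g <= n.+1%:R * m.
Proof.
move=> gm m0; apply: top_norm_le => [|A]; first by rewrite mulr_ge0.
exact: coord_sqr_le_n.
Qed.

Definition day_weight (n : nat) : R := 2^-1 ^+ n / n.+1%:R.

Definition day_partial (n : nat) g : R :=
  \sum_(j < n) day_weight j * top_norm j g.

(** A relative of Day's norm on [c_0(I)], pulled back to [X^*] by the
    coordinates. The weights bound the sum by twice the supremum norm of the
    coordinates, and summing makes an equality in the triangle inequality
    hold for every [n] at once. *)
Definition day_norm g : R := sup (range (fun n => day_partial n g)).

Lemma day_weight_gt0 n : 0 < day_weight n.
Proof. by rewrite divr_gt0// exprn_gt0// invr_gt0. Qed.

Lemma day_partial_bound n g (m : R) : (forall i, rn (g (x i)) <= m) -> 0 <= m ->
  day_partial n g <= 2 * m.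
Proof.
move=> gm m0.
have le j : day_weight j * top_norm j g <= 2^-1 ^+ j * m.
  have := top_norm_bound j gm m0; rewrite -(ler_pM2l (day_weight_gt0 j)).
  move=> /le_trans; apply; rewrite /day_weight mulrA divfK//.
have : day_partial n g <= (2 - 2 * 2^-1 ^+ n) * m.
  rewrite /day_partial; elim: n => [|n IH].
    by rewrite big_ord0 expr0 mulr1 subrr mul0r.
  rewrite big_ord_recr /=; apply: le_trans (lerD IH (le n)) _.
  by rewrite exprS mulrA mulfV// mul1r -mulrDl; apply: ler_wpM2r => //; lra.
move=> /le_trans; apply; apply: ler_wpM2r => //.
by rewrite gerBl mulr_ge0// exprn_ge0// invr_ge0.
Qed.

Lemma day_partial_le n g : day_partial n g <= day_norm g.
Proof.
apply: ub_le_sup; last by exists n.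
exists (2 * rn g) => _ [j _ <-]; apply: day_partial_bound (rn_ge0 _) => i.
exact: rn_coord.
Qed.

Lemma day_norm_le g (b : R) : (forall n, day_partial n g <= b) -> day_norm g <= b.
Proof.
by move=> H; apply: ge_sup => [|_ [n _ <-]//]; exists (day_partial 0 g), 0%N.
Qed.

Lemma day_norm_bound g (m : R) : (forall i, rn (g (x i)) <= m) -> 0 <= m ->
  day_norm g <= 2 * m.
Proof. by move=> gm m0; apply: day_norm_le => n; exact: day_partial_bound. Qed.

Lemma day_norm_rn g : day_norm g <= 2 * rn g.
Proof. by apply: day_norm_bound (rn_ge0 _) => i; exact: rn_coord. Qed.

Lemma day_norm_ge0 g : 0 <= day_norm g.
Proof. by have := day_partial_le 0 g; rewrite /day_partial big_ord0. Qed.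

Lemma day_partialD n g h : day_partial n (g + h) <= day_partial n g + day_partial n h.
Proof.
rewrite -big_split /=; apply: ler_sum => j _.
by rewrite -mulrDr ler_pM2l ?day_weight_gt0 ?top_normD.
Qed.

Lemma day_norm_seminorm : seminorm day_norm.
Proof.
have Zle a g : day_norm (a *: g) <= rn a * day_norm g.
  apply: day_norm_le => n; apply: le_trans (ler_wpM2l (rn_ge0 _) (day_partial_le n g)).
  rewrite /day_partial mulr_sumr; apply: ler_sum => j _.
  by rewrite mulrCA ler_pM2l ?day_weight_gt0 ?top_normZ_le.
split=> [g h|a g].
  apply: day_norm_le => n; apply: le_trans (day_partialD n g h) _.
  by apply: lerD; exact: day_partial_le.
apply/le_anti; rewrite Zle /=; have [->|/eqP a0] := eqVneq a 0.
  by rewrite rn0 mul0r day_norm_ge0.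
rewrite -ler_pdivlMl ?rn_gt0//; have := Zle a^-1 (a *: g).
rewrite scalerA mulVf ?scale1r; last exact/eqP.
have -> // : rn a^-1 = (rn a)^-1.
have na : rn a != 0 by rewrite gt_eqF// rn_gt0.
apply: (mulfI na); rewrite mulfV// -rnM mulfV ?rn1//; exact/eqP.
Qed.

Lemma day_norm_coord g i : rn (g (x i)) <= 4 * day_norm g.
Proof.
have := day_partial_le 2 g; rewrite /day_partial !big_ord_recr big_ord0 /= add0r.
have := rn_coord_top 0 i g; have := top_norm_ge0 0 g.
by rewrite /day_weight expr0 expr1; lra.
Qed.

Lemma day_norm_eq0 g : day_norm g = 0 -> g = 0.
Proof.
move=> g0; apply: coord_inj => i; apply: rn_le0.
by have := day_norm_coord g i; rewrite g0 mulr0.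
Qed.

(** The defects of the triangle inequality are nonnegative and their weighted
    sum is zero. *)
Lemma day_normD_eq g h : day_norm (g + h) = day_norm g + day_norm h ->
  forall n, top_norm n (g + h) = top_norm n g + top_norm n h.
Proof.
move=> E n; apply/le_anti; rewrite top_normD /= leNgt; apply/negP => lt.
pose c := day_weight n * (top_norm n g + top_norm n h - top_norm n (g + h)).
have c0 : 0 < c by rewrite mulr_gt0 ?day_weight_gt0// subr_gt0.
suff : day_norm (g + h) <= day_norm g + day_norm h - c by rewrite E; lra.
have gap m : (n < m)%N -> day_partial m (g + h) <= day_norm g + day_norm h - c.
  move=> nm; have := day_partial_le m g; have := day_partial_le m h.
  suff : c <= day_partial m g + day_partial m h - day_partial m (g + h) by lra.
  rewrite -big_split -sumrB (bigD1 (Ordinal nm))//= /c.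
  rewrite -mulrDr -mulrBr lerDl; apply: sumr_ge0 => j _.
  by rewrite -mulrDr -mulrBr mulr_ge0 ?subr_ge0 ?top_normD//; exact/ltW/day_weight_gt0.
apply: day_norm_le => m; apply: le_trans (gap (maxn m n.+1) _); last exact: leq_maxr.
rewrite /day_partial; set M := maxn m n.+1.
rewrite -!(big_mkord xpredT (fun j => day_weight j * top_norm j (g + h))).
rewrite (big_cat_nat (leq0n m) (leq_maxl m n.+1 : (m <= M)%N))//= lerDl.
by apply: sumr_ge0 => j _; rewrite mulr_ge0 ?top_norm_ge0//; exact/ltW/day_weight_gt0.
Qed.

(** A near maximiser for [top_norm n (g + h)] is one for [top_norm n g] too, and
    for large [n] it contains any given [i] in the support of [g]: otherwise
    exchanging a small coordinate for the [i]-th would exceed the maximum. *)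
Lemma top_norm_proportional g h i :
  (forall n, top_norm n (g + h) = top_norm n g + top_norm n h) ->
  g (x i) <> 0 -> exists n0, forall n, (n0 <= n)%N ->
  0 < top_norm n g /\ sc_of (top_norm n h) * g (x i) = sc_of (top_norm n g) * h (x i).
Proof.
move=> E gi; have gi0 : 0 < rn (g (x i)) by exact: rn_gt0.
have t0 := gi0 => {gi}.
have [t tE] : exists t, t = rn (g (x i)) by exists (rn (g (x i))).
rewrite -tE in t0.
(* once [n] exceeds the number of coordinates above [t / 2], a selection of size
   [n] has a coordinate that is at most [t / 2] *)
have [s sP] := coord_c0 g (divr_gt0 t0 (ltr0n R 2)).
exists (size s).+1 => -[//|n] sn.
have a0 : 0 < top_norm n.+1 g := lt_le_trans gi0 (rn_coord_top n i g).
have b0 := top_norm_ge0 n.+1 h.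
move: (E n.+1) a0 b0 (rn_coord_top n i h).
have ga A (An : selection n.+1 A) := coord_sqr_top g An.
have hb A (An : selection n.+1 A) := coord_sqr_top h An.
have near := top_norm_adherent n.+1 (g + h).
move: near ga hb; set a := top_norm n.+1 g; set b := top_norm n.+1 h.
move=> near ga hb Eab a0 b0 hib; split=> //.
move: b0; rewrite le_eqVlt => /orP[/eqP b0|b0].
  have /eqP -> : h (x i) == 0 by apply/eqP/rn_le0; rewrite b0.
  by rewrite -b0 sc_of0 mul0r mulr0.
have ab : 0 < a * b by rewrite mulr_gt0.
have apb : 0 < a + b by rewrite addr_gt0.
have abn : 0 <= a + b := ltW apb.
suff le (v : R) : 0 < v -> rn (sc_of b * g (x i) - sc_of a * h (x i)) ^+ 2 <= v.
  apply/eqP; rewrite -subr_eq0; apply/eqP/rn_le0; rewrite leNgt; apply/negP => v0.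
  have := le _ (divr_gt0 (exprn_gt0 2 v0) (ltr0n R 2)).
  by have := exprn_gt0 2 v0; lra.
(* the first bound on [e] forces [i] into a near maximiser, the second makes the
   defect [D] at most [v] *)
move=> v0; pose e := Num.min (t ^+ 2 / 2) (v / (a * b)).
have t20 : 0 < t ^+ 2 by rewrite exprn_gt0.
have e0 : 0 < e by rewrite lt_min !divr_gt0.
have et : e <= t ^+ 2 / 2 by rewrite ge_min lexx.
have ev : a * b * e <= v by rewrite -ler_pdivlMl// mulrC ge_min lexx orbT.
have [A An QA] := near e e0; rewrite Eab in QA.
have := coord_sqrD a b A g h; set D := \sum_(j <- A) _ => ED.
have D0 : 0 <= D by apply: sumr_ge0 => j _; exact: sqr_ge0.
have gA := ga A An; have hA := hb A An.
have Qab : a * b * ((a + b) ^+ 2 - e) <= a * b * coord_sqr A (g + h).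
  by rewrite ler_pM2l// ltW.
have De : D <= a * b * e.
  have : (a + b) * (b * coord_sqr A g + a * coord_sqr A h) <=
         (a + b) * (b * a ^+ 2 + a * b ^+ 2).
    by apply: ler_wpM2l => //; apply: lerD; apply: ler_wpM2l => //; exact: ltW.
  have -> : (a + b) * (b * a ^+ 2 + a * b ^+ 2) = a * b * (a + b) ^+ 2 by ring.
  by move: Qab; rewrite mulrBr; lra.
have gAe : a ^+ 2 - e <= coord_sqr A g.
  have : a * b * ((a + b) ^+ 2 - e) <= (a + b) * (b * coord_sqr A g + a * b ^+ 2).
    apply: (@le_trans _ _ ((a + b) * (b * coord_sqr A g + a * coord_sqr A h))).
      by rewrite -ED; apply: le_trans Qab _; rewrite lerDl.
    by apply: ler_wpM2l => //; rewrite lerD2l; apply: ler_wpM2l => //; exact: ltW.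
  have -> : a * b * ((a + b) ^+ 2 - e) =
      (a + b) * (b * (a ^+ 2 - e) + a * b ^+ 2) + b ^+ 2 * e by ring.
  have be0 : 0 <= b ^+ 2 * e by rewrite mulr_ge0 ?sqr_ge0// ltW.
  move=> h1; have h2 := le_trans (ler_wpDr be0 (lexx _)) h1.
  by move: h2; rewrite ler_pM2l// lerD2r ler_pM2l.
have iA : i \in A.
  apply: contrapT => /negP iA; have [Au As] := An.
  have [lt|/(conj As)/andP] := ltnP (size A) n.+1.
    have iAs : selection n.+1 (i :: A) by split=> //=; rewrite iA.
    have := ga _ iAs; rewrite /coord_sqr big_cons -/(coord_sqr A g) -tE => le.
    by move: le gAe et t20; move: (coord_sqr A g) (t ^+ 2) (a ^+ 2) (e) => *; lra.
  rewrite -eqn_leq => /eqP sA.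
  have [j jA js] : exists2 j, j \in A & j \notin s.
    apply: contrapT => /forall2NP H.
    have : {subset A <= s} by move=> j jA; have [//|/negP/negPn] := H j.
    by move=> /(uniq_leq_size Au); rewrite sA leqNgt sn.
  have jrem : selection n.+1 (i :: rem j A).
    split=> /=; last by rewrite size_rem// sA.
    by rewrite rem_uniq// andbT; apply: contra iA; exact: mem_rem.
  have := ga _ jrem; rewrite /coord_sqr big_cons -tE.
  move: gAe; rewrite /coord_sqr (big_rem j)//= => le1 le2.
  have le3 : rn (g (x j)) ^+ 2 <= (t / 2) ^+ 2.
    by rewrite ler_pXn2r ?nnegrE ?rn_ge0 ?sP// divr_ge0// ltW.
  rewrite expr_div_n -natrX in le3.
  move: le1 le2 le3 et t20; move: (rn _ ^+ 2) (\sum_(z <- rem j A) _).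
  by move: (t ^+ 2) (a ^+ 2) (e) => *; lra.
apply: le_trans ev; apply: le_trans De; rewrite /D (big_rem i)//= lerDl.
by apply: sumr_ge0 => j _; exact: sqr_ge0.
Qed.

(** All ratios [h (x i) / g (x i)] equal [top_norm n h / top_norm n g] for large
    [n], so they do not depend on [i]. *)
Lemma day_norm_strict g h : day_norm (g + h) = day_norm g + day_norm h ->
  sc_of (day_norm h) *: g = sc_of (day_norm g) *: h.
Proof.
move=> /day_normD_eq E.
have E' n : top_norm n (h + g) = top_norm n h + top_norm n g by rewrite addrC E addrC.
have [g0|/existsNP[j gj]] := pselect (forall i, g (x i) = 0).
  have -> : g = 0 by apply: coord_inj => i; rewrite g0.
  have -> : day_norm 0 = 0.
    by have := day_norm_seminorm.2 0 (0 : dual X); rewrite scale0r rn0 mul0r.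
  by rewrite sc_of0 scale0r scaler0.
have [nj njP] := top_norm_proportional E gj.
pose r := top_norm nj h / top_norm nj g.
have [aj0 _] := njP nj (leqnn _).
have r0 : 0 <= r by rewrite divr_ge0 ?top_norm_ge0.
have ratio n (u v : K) : 0 < top_norm n g ->
    sc_of (top_norm n h) * u = sc_of (top_norm n g) * v ->
    v = sc_of (top_norm n h / top_norm n g) * u.
  move=> a0 uv; have a1 : sc_of (top_norm n g)^-1 * sc_of (top_norm n g) = 1 :> K.
    by rewrite -sc_ofM mulVf ?gt_eqF// sc_of1.
  by rewrite -[v]mul1r -a1 -mulrA -uv mulrA -sc_ofM mulrC [_ * top_norm n h]mulrC mulrC.
have hE : h = sc_of r *: g.
  apply: coord_inj => i; rewrite dualZE.
  have [gi|gi] := pselect (g (x i) = 0).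
    rewrite gi mulr0; apply: contrapT => hi.
    have [ni niP] := top_norm_proportional E' hi.
    have [_] := niP _ (leq_maxl ni nj); rewrite gi mulr0 => /eqP.
    rewrite mulf_eq0 => /orP[/eqP a0|/eqP//].
    have [] := njP _ (leq_maxr ni nj).
    by rewrite -(@sc_ofK R k (top_norm _ g)) a0 sc_re0 ltxx.
  have [ni niP] := top_norm_proportional E gi.
  have [a0 /(ratio _ _ _ a0) hi] := niP _ (leq_maxl ni nj).
  have [_ /(ratio _ _ _ a0) hj] := njP _ (leq_maxr ni nj).
  have [_ /(ratio _ _ _ aj0) hj'] := njP nj (leqnn _).
  rewrite hi; congr (_ * _); apply: (mulIf (introN eqP gj)).
  by rewrite -hj hj'.
have hr : day_norm h = r * day_norm g.
  by rewrite hE day_norm_seminorm.2 rn_sc_of.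
by rewrite hr hE scalerA -sc_ofM mulrC.
Qed.

Lemma linear_span_coord h : linear_span f h -> exists s0, forall s, uniq s ->
  {subset s0 <= s} -> h = \sum_(i <- s) h (x i) *: f i.
Proof.
move=> [s hE]; exists (map snd s) => s' us' ss'.
apply: coord_inj => j; rewrite dual_sumE.
have -> : \sum_(i <- s') (h (x i) *: f i) (x j) =
          \sum_(i <- s' | i == j) h (x j).
  rewrite [RHS]big_mkcond; apply: eq_bigr => i _; rewrite dualZE biorthogonalE.
  by case: eqP => [->|_]; rewrite ?mulr1 ?mulr0.
have [js|js] := boolP (j \in s').
  by rewrite -big_filter filter_pred1_uniq// big_seq1.
rewrite big_seq_cond big1 => [|i /andP[is' /eqP ij]]; last by rewrite -ij is' in js.
rewrite hE dual_sumE big_seq big1// => -[a i] is_; rewrite dualZE biorthogonalE.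
case: eqP => [ij|_]; last by rewrite mulr0.
by move: js; rewrite -ij ss'//; apply/mapP; exists (a, i).
Qed.

(** The combination of the [f i] with unimodular coefficients that make all
    terms [F (f i)] positive has coordinates of modulus at most one. *)
Lemma day_dominated_summable (F : dual (dual X)) s : (forall g, rn (F g) <= day_norm g) ->
  uniq s -> \sum_(i <- s) rn (F (f i)) <= 2.
Proof.
move=> Fq us; have /boolp.choice[t tP] i : exists t : K,
    rn t = 1 /\ t * F (f i) = sc_of (rn (F (f i))).
  by have [t t1 t2] := sc_phase (F (f i)); exists t.
pose h := \sum_(i <- s) t i *: f i.
have Fh : F h = sc_of (\sum_(i <- s) rn (F (f i))).
  rewrite linear_sum /=; elim: {us h} s => [|i s IH]; first by rewrite !big_nil sc_of0.
  by rewrite !big_cons sc_ofD -IH -(tP i).2 linearZ.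
have hx i : rn (h (x i)) <= 1.
  have -> : h (x i) = \sum_(j <- s | j == i) t i.
    rewrite dual_sumE [RHS]big_mkcond; apply: eq_bigr => j _.
    by rewrite dualZE biorthogonalE; case: eqP => [->|_]; rewrite ?mulr1 ?mulr0.
  have [si|si] := boolP (i \in s).
    by rewrite -big_filter filter_pred1_uniq// big_seq1 (tP i).1.
  rewrite big_seq_cond big1 ?rn0// => j /andP[js /eqP ji].
  by rewrite -ji js in si.
have := Fq h; rewrite Fh rn_sc_of; last by apply: sumr_ge0 => i _; exact: rn_ge0.
by move=> /le_trans; apply; have := day_norm_bound hx ler01; rewrite mulr1.
Qed.

(** When the finite set [A] nearly exhausts the sum of all [rn (F (f i))], the
    vector with coefficients [F (f i)] for [i] in [A] is close to [F], as the
    coordinates of a functional are bounded by its norm. *)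
Lemma day_dominated_embedding (F : dual (dual X)) :
  closed (range (@bidual_embedding R k X)) ->
  (forall g, rn (F g) <= day_norm g) -> range (@bidual_embedding R k X) F.
Proof.
move=> clX Fq; apply: clX; apply: approx_closure => e e0.
pose S := [set \sum_(i <- s) rn (F (f i)) | s in [set s | uniq s]].
have S0 : S !=set0 by exists (\sum_(i <- [::]) rn (F (f i))), [::].
have Sub : has_ubound S by exists 2 => _ [s us <-]; exact: day_dominated_summable.
have [_ [A Au <-] eA] := sup_adherent e0 (conj S0 Sub).
pose y := \sum_(i <- A) F (f i) *: x i.
exists (bidual_embedding y); first by exists y.
case: (ltVle e (rn (F - bidual_embedding y))) => // lt.
have [h [fh h1]] := dense_norming (@linear_spanZ _ _ _ _ f) f_dense (ltW e0) lt.
have [s0 hs0] := linear_span_coord fh.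
pose J := undup (A ++ s0).
have hJ : h = \sum_(i <- J) h (x i) *: f i.
  by apply: hs0; rewrite ?undup_uniq// => i is0; rewrite mem_undup mem_cat is0 orbT.
have AJ (V : nmodType) (G : I -> V) :
    \sum_(i <- J) G i = \sum_(i <- A) G i + \sum_(i <- J | i \notin A) G i.
  rewrite (bigID (mem A))/=; congr (_ + _); rewrite -big_filter.
  apply: perm_big; apply: uniq_perm => // [|i]; first by rewrite filter_uniq ?undup_uniq.
  by rewrite mem_filter mem_undup mem_cat /=; case: (i \in A).
have Ey : (F - bidual_embedding y) h = \sum_(i <- J | i \notin A) h (x i) * F (f i).
  rewrite dualBE /= {1}hJ linear_sum /= AJ.
  have -> : h y = \sum_(i <- A) h (x i) * F (f i).
    by rewrite /y linear_sum; apply: eq_bigr => i _; rewrite linearZ; exact: mulrC.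
  rewrite addrAC [X in X - _](_ : _ = \sum_(i <- A) h (x i) * F (f i)).
    by rewrite subrr add0r; apply: eq_bigr => i _; rewrite linearZ.
  by apply: eq_bigr => i _; rewrite linearZ.
rewrite Ey => he.
have : \sum_(i <- J) rn (F (f i)) <= sup S.
  by apply: ub_le_sup => //; exists J => //; exact: undup_uniq.
rewrite AJ => AJle.
have : rn (\sum_(i <- J | i \notin A) h (x i) * F (f i)) <=
       \sum_(i <- J | i \notin A) rn (F (f i)).
  rewrite -!(big_filter J); apply: le_trans (rn_sum _ _) _; apply: ler_sum => i _.
  rewrite rnM -[leRHS]mul1r ler_wpM2r ?rn_ge0//.
  exact: le_trans (rn_coord h i) h1.
by move: he eA AJle; rlra.
Qed.

End day_norm.

(** * The renorming *)

Section general.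
Context {R : realType} {k : scalar_kind}.
Local Notation K := (scalars R k).

Lemma rn_dual_ge_ball (V : normedModType K) (f : dual V) (M : R) :
  (forall x, rn x <= 1 -> sc_re (f x) <= M) -> rn f <= M.
Proof.
move=> fM; apply/ler_addgt0Pr => e e0.
have [x x1] := rn_dual_adherent f e0.
by have := fM x x1; rlra.
Qed.

Lemma rn_eq1 (T : normedZmodType K) (x : T) : `|x| = 1 <-> rn x = 1.
Proof.
rewrite -rnK -(@sc_of1 R k); split=> [|->//].
by move/(congr1 (@sc_re R k)); rewrite !sc_ofK.
Qed.

(** Two norming functionals of [x] span a segment of norming functionals. *)
Lemma strictly_convex_dual_smooth (V : normedModType K) :
  strictly_convex (dual V) -> smooth V.
Proof.
move=> sc x /rn_eq1 x1; have [f [f1 fx]] := norming_functional x.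
rewrite x1 sc_of1 in fx.
have ge1 (g : dual V) : g x = 1 -> 1 <= rn g.
  move=> gx; have := rn_dual_le g x; rewrite gx x1 mulr1 => h.
  by apply: le_trans h; rewrite -(@rn1 R k).
have fn : rn f = 1 by apply/le_anti; rewrite f1 ge1.
exists f; split; first by split=> //; exact/rn_eq1.
move=> g [/rn_eq1 gn gx]; apply: sc => t /andP[t0 t1]; apply/rn_eq1.
apply/le_anti/andP; split; last first.
  by apply: ge1; rewrite dualDE !dualZE fx gx !mulr1 addrC subrK.
apply: le_trans (rnD _ _) _; rewrite !rnZ fn gn !mulr1.
have tE : t = sc_of (sc_re t) by rewrite sc_reK.
have r0 : 0 <= sc_re t by rewrite -(@sc_of_ge0 R k) -tE.
have r1 : 0 <= 1 - sc_re t by rewrite -(@sc_of_ge0 R k) sc_ofB sc_of1 -tE subr_ge0.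
by rewrite tE -(@sc_of1 R k) -sc_ofB !rn_sc_of// addrC subrK.
Qed.

Lemma natural_projection_ideal (V : normedModType K) :
  ideal_projection (range (@bidual_embedding R k V)) (@natural_projection R k V).
Proof.
split.
- move=> a phi psi; rewrite /natural_projection restriction_linear.
  exact: bidual_embedding_linear.
- by move=> phi; apply: dualP => F; congr (F _); apply: dualP.
- by move=> phi; rewrite rn_le rn_bidual_embedding rn_restriction.
- apply/seteqP; split=> [phi /= phi0 _ [x _ <-]|phi phi0 /=].
    by have := congr1 (fun u : dual (dual (dual V)) => u (bidual_embedding x)) phi0.
  have r0 : restriction phi = 0.
    by apply: dualP => x /=; apply: phi0; exists x.
  by rewrite /natural_projection r0; apply: dualP => F /=; rewrite linear0.
Qed.

End general.

Section renorming.
Context {R : realType} {k : scalar_kind}.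
Local Notation K := (scalars R k).
Variables (X : normedModType K) (q : dual X -> R).
Implicit Types (g h : dual X).
Hypothesis q_seminorm : seminorm q.
Hypothesis q_rn : forall g, q g <= 2 * rn g.
Hypothesis q_dominated : forall F : dual (dual X), (forall g, rn (F g) <= q g) ->
  range (@bidual_embedding R k X) F.

(** The norm of [X^*] that is to become a dual norm. *)
Let r (g : dual X) : R := rn g + q g.

Let q0 g : 0 <= q g := seminorm_ge0 g q_seminorm.

Let r0 g : 0 <= r g. Proof. by rewrite addr_ge0 ?rn_ge0. Qed.

Let rZ a g : r (a *: g) = rn a * r g.
Proof. by rewrite /r rnZ q_seminorm.2 mulrDr. Qed.

Definition predual_norm (x : X) : R := sup [set rn (g x) | g in [set g | r g <= 1]].

Let predual_set_nonempty (x : X) : [set rn (g x) | g in [set g | r g <= 1]] !=set0.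
Proof.
exists (rn ((0 : dual X) x)), 0 => //=.
by rewrite -(scale0r (0 : dual X)) rZ rn0 mul0r.
Qed.

Let rn_le_r g : rn g <= r g. Proof. by rewrite lerDl. Qed.

Let predual_set_bounded (x : X) : has_ubound [set rn (g x) | g in [set g | r g <= 1]].
Proof.
exists (rn x) => _ [g /= g1 <-]; apply: le_trans (rn_dual_le _ _) _.
by rewrite -[leRHS]mul1r ler_wpM2r ?rn_ge0// (le_trans _ g1).
Qed.

Lemma predual_norm_ge g (x : X) : rn (g x) <= r g * predual_norm x.
Proof.
have [g0|g0] := ltVle 0 (r g); last first.
  have -> : g = 0 by apply: rn_le0; exact: le_trans (rn_le_r g) g0.
  by rewrite rn0 -(scale0r (0 : dual X)) rZ rn0 !mul0r.
rewrite -ler_pdivrMl//; apply: ub_le_sup; first exact: predual_set_bounded.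
exists (sc_of (r g)^-1 *: g) => /=.
  by rewrite rZ rn_sc_of ?invr_ge0// mulVf ?gt_eqF.
by rewrite rnM rn_sc_of ?invr_ge0.
Qed.

Lemma predual_norm_le (x : X) (b : R) : (forall g, r g <= 1 -> rn (g x) <= b) ->
  predual_norm x <= b.
Proof.
by move=> H; apply: ge_sup => [|_ [g /= g1 <-]]; [exact: predual_set_nonempty|exact: H].
Qed.

Lemma predual_norm_ge0 (x : X) : 0 <= predual_norm x.
Proof.
apply: le_trans (rn_ge0 ((0 : dual X) x)) _; apply: ub_le_sup.
  exact: predual_set_bounded.
by exists 0 => //=; rewrite -(scale0r (0 : dual X)) rZ rn0 mul0r.
Qed.

Lemma predual_normD (x y : X) :
  predual_norm (x + y) <= predual_norm x + predual_norm y.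
Proof.
apply: predual_norm_le => g g1; rewrite linearD; apply: le_trans (rnD _ _) _.
have le z : rn (g z) <= predual_norm z.
  apply: le_trans (predual_norm_ge g z) _.
  by rewrite -[leRHS]mul1r ler_wpM2r// predual_norm_ge0.
by apply: lerD; exact: le.
Qed.

Lemma predual_normZ a (x : X) : predual_norm (a *: x) = rn a * predual_norm x.
Proof.
have Zle b (y : X) : predual_norm (b *: y) <= rn b * predual_norm y.
  apply: predual_norm_le => g g1; rewrite linearZ rnZ ler_wpM2l ?rn_ge0//.
  apply: le_trans (predual_norm_ge g y) _.
  by rewrite -[leRHS]mul1r ler_wpM2r// predual_norm_ge0.
apply/le_anti; rewrite Zle /=; have [->|/eqP a0] := eqVneq a 0.
  by rewrite rn0 mul0r predual_norm_ge0.
rewrite -ler_pdivlMl ?rn_gt0//; have := Zle a^-1 (a *: x).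
rewrite scalerA mulVf ?scale1r; last exact/eqP.
have -> // : rn a^-1 = (rn a)^-1.
have na : rn a != 0 by rewrite gt_eqF// rn_gt0.
apply: (mulfI na); rewrite mulfV// -rnM mulfV ?rn1//; exact/eqP.
Qed.

Lemma predual_norm_rn (x : X) : predual_norm x <= rn x.
Proof.
apply: predual_norm_le => g g1; apply: le_trans (rn_dual_le _ _) _.
by rewrite -[leRHS]mul1r ler_wpM2r ?rn_ge0// (le_trans _ g1).
Qed.

Let r_le g : r g <= 3 * rn g.
Proof. by rewrite /r; have := q_rn g; rlra. Qed.

Lemma rn_predual_norm (x : X) : rn x <= 3 * predual_norm x.
Proof.
have [g [g1 gx]] := norming_functional x.
have := predual_norm_ge g x; rewrite gx rn_sc_of ?rn_ge0// => /le_trans; apply.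
rewrite ler_wpM2r ?predual_norm_ge0//; apply: le_trans (r_le g) _.
by move: g1; rlra.
Qed.

Lemma predual_norm_equivalent : exists m M : K,
  [/\ 0 < m, 0 < M &
   forall x : X, m * `|x| <= sc_of (predual_norm x) <= M * `|x|].
Proof.
exists (sc_of 3^-1), (sc_of 1).
split; rewrite -?(@sc_of0 R k) ?ltr_sc_of ?invr_gt0// => x.
rewrite -rnK -!sc_ofM !ler_sc_of mul1r predual_norm_rn andbT.
by rewrite ler_pdivrMl//; exact: rn_predual_norm.
Qed.

Lemma sc_predual_normD (x y : X) : sc_of (predual_norm (x + y)) <=
  sc_of (predual_norm x) + sc_of (predual_norm y) :> K.
Proof. by rewrite -sc_ofD ler_sc_of predual_normD. Qed.

Lemma sc_predual_normZ (a : K) (x : X) :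
  sc_of (predual_norm (a *: x)) = `|a| * sc_of (predual_norm x) :> K.
Proof. by rewrite predual_normZ sc_ofM rnK. Qed.

Definition predual_renorming : equivalent_norm X :=
  EquivalentNorm sc_predual_normD sc_predual_normZ predual_norm_equivalent.

Local Notation XN := (renormed predual_renorming).

Lemma rn_renormed (x : XN) : rn x = predual_norm x.
Proof.
by rewrite -[LHS](@sc_ofK R k) rnK renormedE /= sc_ofK.
Qed.

(** The Hahn-Banach theorem yields an element of the bidual dominated by [q]
    that attains [q g]; the hypothesis on [q] places it in [X]. *)
Lemma dominated_vector g :
  exists2 z : X, (forall h : dual X, rn (h z) <= q h) & g z = sc_of (q g).
Proof.
have [F [Fl Fq Fg]] := hahn_banach_norming g q_seminorm.
have [F' F'E] : exists F' : dual (dual X), forall h, F' h = F h.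
  by apply: (@dual_of _ _ _ F 2) => // h; exact: le_trans (Fq h) (q_rn h).
have [|z _ zF] := @q_dominated F'; first by move=> h; rewrite F'E.
by exists z => [h|]; [have := Fq h|]; rewrite -?Fg -F'E -zF.
Qed.

Lemma to_renormed_dual_pred g : (fun x : XN => g x) \in @dual_pred _ _ XN.
Proof.
apply: (@bounded_dual_pred _ _ XN _ (sc_of (r g))); rewrite ?sc_of_ge0//.
  by move=> a x y; rewrite linearP.
by move=> x; rewrite -!rnK -sc_ofM ler_sc_of rn_renormed; exact: predual_norm_ge.
Qed.

Definition to_renormed_dual g : dual XN := Dual (to_renormed_dual_pred g).

Lemma of_renormed_dual_pred (G : dual XN) : (fun x : X => G x) \in @dual_pred _ _ X.
Proof.
apply: (@bounded_dual_pred _ _ X _ `|G|) => //.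
  by move=> a x y; exact: (linearP G).
move=> x; rewrite -!rnK -sc_ofM ler_sc_of.
apply: le_trans (rn_dual_le G x) _; rewrite rn_renormed.
by rewrite ler_wpM2l ?rn_ge0// predual_norm_rn.
Qed.

Definition of_renormed_dual (G : dual XN) : dual X := Dual (of_renormed_dual_pred G).

(** The new unit ball of [X] contains the sums of vectors of the old one and of
    vectors dominated by [q], and over such sums [g] has the supremum [r g]. *)
Lemma rn_to_renormed_dual g : rn (to_renormed_dual g) = r g.
Proof.
apply/le_anti/andP; split.
  by apply: rn_dual_ge => // x; rewrite rn_renormed; exact: predual_norm_ge.
have [z zq gz] := dominated_vector g.
apply/ler_addgt0Pr => e e0; have [y y1 gy] := rn_dual_adherent g e0.
have yz : rn (y + z : XN) <= 1.
  rewrite rn_renormed; apply: predual_norm_le => h h1; rewrite linearD.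
  apply: le_trans (rnD _ _) _; apply: le_trans h1; apply: lerD; last exact: zq.
  exact: rn_dual_le1.
have gyz : sc_re (g (y + z)) = sc_re (g y) + q g.
  by rewrite dual_mapD sc_reD gz sc_ofK.
have : sc_re (g (y + z)) <= rn (to_renormed_dual g).
  apply: le_trans (sc_re_le _) _.
  exact: (@rn_dual_le1 _ _ XN (to_renormed_dual g) (y + z : XN) _ (lexx _) yz).
by rewrite gyz /r; move: gy; rlra.
Qed.

Lemma of_renormed_dualK G : to_renormed_dual (of_renormed_dual G) = G.
Proof. exact: dualP. Qed.

Lemma rn_renormed_dual G : rn G = rn (of_renormed_dual G) + q (of_renormed_dual G).
Proof. by rewrite -{1}[G]of_renormed_dualK rn_to_renormed_dual. Qed.

Lemma to_renormed_bidual_pred (F : dual (dual X)) :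
  (fun G : dual XN => F (of_renormed_dual G)) \in @dual_pred _ _ (dual XN).
Proof.
apply: (@bounded_dual_pred _ _ (dual XN) _ `|F|) => //.
  move=> a G H; rewrite -linearP; congr (F _); exact: dualP.
move=> G; rewrite -!rnK -sc_ofM ler_sc_of; apply: le_trans (rn_dual_le _ _) _.
by rewrite ler_wpM2l ?rn_ge0// [leRHS]rn_renormed_dual lerDl.
Qed.

Definition to_renormed_bidual F : dual (dual XN) := Dual (to_renormed_bidual_pred F).

Lemma of_renormed_bidual_pred (F : dual (dual XN)) :
  (fun g : dual X => F (to_renormed_dual g)) \in @dual_pred _ _ (dual X).
Proof.
apply: (@bounded_dual_pred _ _ (dual X) _ (sc_of (3 * rn F))).
- move=> a g h; rewrite -linearP; congr (F _); exact: dualP.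
- by rewrite sc_of_ge0 mulr_ge0 ?rn_ge0.
- move=> g; rewrite -!rnK -sc_ofM ler_sc_of; apply: le_trans (rn_dual_le _ _) _.
  rewrite rn_to_renormed_dual -mulrA mulrCA ler_wpM2l ?rn_ge0//; exact: r_le.
Qed.

Definition of_renormed_bidual F : dual (dual X) := Dual (of_renormed_bidual_pred F).

Lemma of_renormed_bidualK F : to_renormed_bidual (of_renormed_bidual F) = F.
Proof. by apply: dualP => G /=; rewrite of_renormed_dualK. Qed.

Lemma rn_to_renormed_bidual (F : dual (dual X)) (b : R) : 0 <= b ->
  (forall g, rn (F g) <= b * r g) -> rn (to_renormed_bidual F) <= b.
Proof.
by move=> b0 Fb; apply: rn_dual_ge => // G; rewrite [rn G]rn_renormed_dual; exact: Fb.
Qed.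

Lemma of_renormed_tridual_pred (phi : dual (dual (dual XN))) :
  (fun F : dual (dual X) => phi (to_renormed_bidual F)) \in
  @dual_pred _ _ (dual (dual X)).
Proof.
apply: (@bounded_dual_pred _ _ (dual (dual X)) _ `|phi|) => //.
  move=> a F G; rewrite -linearP; congr (phi _); exact: dualP.
move=> F; rewrite -!rnK -sc_ofM ler_sc_of; apply: le_trans (rn_dual_le _ _) _.
rewrite ler_wpM2l ?rn_ge0//; apply: rn_to_renormed_bidual; first exact: rn_ge0.
by move=> g; apply: le_trans (rn_dual_le _ _) _; rewrite ler_wpM2l ?rn_ge0.
Qed.

Definition of_renormed_tridual phi : dual (dual (dual X)) :=
  Dual (of_renormed_tridual_pred phi).

(** Every functional in the new unit ball of [X^**] is the sum of one in the old
    ball and a vector of [X] dominated by [q]; on the latter an element of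
    [X^***] agrees with its restriction to [X]. *)
Lemma rn_renormed_tridual phi : rn phi =
  rn (of_renormed_tridual phi) + q (restriction (of_renormed_tridual phi)).
Proof.
set psi := of_renormed_tridual phi; apply/le_anti/andP; split.
  apply: rn_dual_ge_ball => F F1; rewrite -[F]of_renormed_bidualK.
  set E := of_renormed_bidual F.
  have Er g : rn (E g) <= rn g + q g.
    apply: le_trans (rn_dual_le F (to_renormed_dual g)) _.
    by rewrite rn_to_renormed_dual -[leRHS]mul1r; exact: ler_wpM2r.
  have rs : seminorm (fun g : dual X => rn g) by split; [exact: rnD|exact: rnZ].
  have [H [Hl Hq EH]] := hahn_banach_split rs q_seminorm (linearP E) Er.
  have [H' H'E] : exists H' : dual (dual X), forall g, H' g = H g.
    by apply: (@dual_of _ _ _ H 2) => // g; exact: le_trans (Hq g) (q_rn g).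
  have [|z _ zH] := @q_dominated H'; first by move=> g; rewrite H'E.
  have zq : rn (restriction psi z) <= q (restriction psi).
    by have := Hq (restriction psi); rewrite -H'E -zH.
  have EH1 : rn (E - H') <= 1.
    by apply: rn_dual_ge => // g; rewrite mul1r dualBE H'E; exact: EH.
  have -> : phi (to_renormed_bidual E) = psi (E - H') + restriction psi z.
    have -> : restriction psi z = psi H' by rewrite -zH.
    by rewrite -dual_mapD subrK.
  apply: le_trans (sc_re_le _) _; apply: le_trans (rnD _ _) _.
  by apply: lerD => //; exact: rn_dual_le1.
have [z zq gz] := dominated_vector (restriction psi).
apply/ler_addgt0Pr => e e0; have [E E1 psiE] := rn_dual_adherent psi e0.
have Ez : rn (to_renormed_bidual (E + bidual_embedding z)) <= 1.
  apply: rn_to_renormed_bidual => // g; rewrite mul1r dualDE.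
  apply: le_trans (rnD _ _) _; apply: lerD; last exact: zq.
  by apply: le_trans (rn_dual_le _ _) _; rewrite -[leRHS]mul1r ler_wpM2r ?rn_ge0.
have := le_trans (sc_re_le _) (rn_dual_le1 (lexx (rn phi)) Ez).
rewrite -[phi _]/(psi (E + bidual_embedding z)) dual_mapD sc_reD.
have -> : psi (bidual_embedding z) = sc_of (q (restriction psi)) by exact: gz.
by rewrite sc_ofK; move: psiE; rlra.
Qed.

Lemma of_renormed_tridual_linear : linear of_renormed_tridual.
Proof. by move=> a phi psi; apply: dualP. Qed.

Lemma of_renormed_natural_projection phi :
  of_renormed_tridual (natural_projection phi) =
  natural_projection (of_renormed_tridual phi).
Proof.
apply: dualP => F /=; congr (F _); apply: dualP => x /=; congr (phi _).
by apply: dualP.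
Qed.

Lemma renormed_embedding_closed : closed (range (@bidual_embedding R k X)) ->
  closed (range (@bidual_embedding R k XN)).
Proof.
move=> clX F clF.
have : closure (range (@bidual_embedding R k X)) (of_renormed_bidual F).
  apply: approx_closure => e e0; have e3 : 0 < e / 3 by lra.
  have [_ [x _ <-] Fx] := closure_approx e3 clF.
  exists (bidual_embedding (x : X)); first by exists x.
  apply: rn_dual_ge (ltW e0) _ => g.
  have := rn_dual_le (F - bidual_embedding x) (to_renormed_dual g).
  rewrite rn_to_renormed_dual => /le_trans; apply.
  have -> : e * rn g = e / 3 * (3 * rn g) by field.
  by apply: ler_pM => //; rewrite ?rn_ge0.
move/clX => [x _ xF]; exists (x : XN) => //.
by rewrite -[F]of_renormed_bidualK -xF; apply: dualP.
Qed.

(** By [rn_renormed_tridual] the inequality splits into the old one and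
    [(rn (a + b) + c) * q g <= q g] for the restriction [g]; the latter follows
    from the old inequality at the image of [g] in [X^***]. *)
Lemma renormed_canonical (a : K) (B : set K) (c : K) : 0 <= c ->
  canonical_aBc_ideal a B c X -> canonical_aBc_ideal a B c XN.
Proof.
move=> c0 [[clX _ _] _ idX].
split; [split|exact: natural_projection_ideal|].
- exact: renormed_embedding_closed.
- by exists 0 => //; rewrite -(scale0r 0); apply: dualP => g /=; rewrite scale0r linear0.
- move=> b _ _ [x _ <-] [y _ <-]; exists (b *: x + y) => //.
  exact: bidual_embedding_linear.
have {c0} [c' [cE c0]] : exists c' : R, c = sc_of c' /\ 0 <= c'.
  by exists (sc_re c); rewrite sc_reK//; split=> //; rewrite -(@sc_of_ge0 R k) sc_reK.
have {}idX b (psi : dual (dual (dual X))) : B b ->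
    rn (a *: psi + b *: natural_projection psi) + c' * rn (natural_projection psi)
    <= rn psi.
  move=> /idX /(_ psi); rewrite cE -!rnK -sc_ofM -sc_ofD ler_sc_of; exact.
move=> b Bb phi; rewrite cE -!rnK -sc_ofM -sc_ofD ler_sc_of !rn_renormed_tridual.
set psi := of_renormed_tridual phi; set g := restriction psi.
have -> : of_renormed_tridual (natural_projection phi) = natural_projection psi.
  exact: of_renormed_natural_projection.
have -> : of_renormed_tridual (a *: phi + b *: natural_projection phi) =
    a *: psi + b *: natural_projection psi.
  rewrite of_renormed_tridual_linear; congr (_ + _).
  by rewrite /psi -of_renormed_natural_projection; exact: dualP.
have -> : restriction (natural_projection psi) = g by exact: dualP.
have -> : restriction (a *: psi + b *: natural_projection psi) = (a + b) *: g.
  by rewrite scalerDl restriction_linear; congr (_ + _); exact: dualP.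
rewrite q_seminorm.2.
have h1 := idX b psi Bb.
have h2 : (rn (a + b) + c') * q g <= q g.
  have h3 : (rn (a + b) + c') * rn g <= rn g.
    have := idX b (bidual_embedding g) Bb.
    have -> : natural_projection (bidual_embedding g) = bidual_embedding g.
      by apply: dualP => F /=; congr (F _); exact: dualP.
    by rewrite -scalerDl rnZ rn_bidual_embedding -mulrDl.
  have [g0|g0] := ltVle 0 (rn g); last first.
    by rewrite (rn_le0 g0) -(scale0r (0 : dual X)) q_seminorm.2 rn0 mul0r mulr0.
  by rewrite -[leRHS]mul1r ler_wpM2r// -(ler_pM2r g0) mul1r.
by rewrite mulrDr addrACA -mulrDl; exact: lerD h1 h2.
Qed.

(** On a segment of the unit sphere the triangle inequality is an equality for
    [q]; so the end points are proportional, and they have the same norm. *)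
Lemma renormed_strictly_convex :
  (forall g h, q (g + h) = q g + q h -> sc_of (q h) *: g = sc_of (q g) *: h) ->
  (forall g, q g = 0 -> g = 0) -> strictly_convex (dual XN).
Proof.
move=> qstrict qeq0 u v seg.
have nu : rn u = 1.
  by apply/rn_eq1; rewrite -(seg 1) ?lexx ?ler01// scale1r subrr scale0r addr0.
have nv : rn v = 1.
  by apply/rn_eq1; rewrite -(seg 0) ?lexx ?ler01// scale0r subr0 scale1r add0r.
have nuv : rn (u + v) = 2.
  have half : 1 - 2^-1 = 2^-1 :> R by lra.
  have halfK : 1 - sc_of 2^-1 = sc_of 2^-1 :> K by rewrite -(@sc_of1 R k) -sc_ofB half.
  have half01 : 0 <= (sc_of 2^-1 : K) <= 1.
    have h1 : sc_of 2^-1 <= sc_of 1 :> K by rewrite ler_sc_of; lra.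
    rewrite sc_of1 in h1; apply/andP; split; last exact: h1.
    by rewrite sc_of_ge0; lra.
  have /rn_eq1 := seg _ half01; rewrite halfK -scalerDr rnZ rn_sc_of; last by lra.
  move=> E; have {}E : 2^-1 * rn (u + v) = 1 by exact: E.
  by rlra.
move: nu nv nuv; rewrite !rn_renormed_dual.
set g := of_renormed_dual u; set h := of_renormed_dual v.
have -> : of_renormed_dual (u + v) = g + h by exact: dualP.
move=> ng nh ngh.
have qgh : q (g + h) = q g + q h.
  apply/le_anti; rewrite q_seminorm.1 /=.
  have : rn (g + h) <= rn g + rn h by exact: rnD.
  by move: ng nh ngh; rlra.
have E := qstrict _ _ qgh.
have rE : q h * rn g = q g * rn h.
  have := congr1 (fun w : dual X => rn w) E.
  by rewrite !rnZ !rn_sc_of.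
have qE : q g = q h.
  have : q h * (rn g + q g) = q g * (rn h + q h).
    by rewrite !mulrDr rE (mulrC (q h) (q g)).
  by rewrite ng nh !mulr1.
rewrite -[u]of_renormed_dualK -[v]of_renormed_dualK -/g -/h; congr to_renormed_dual.
have [g0|g0] := pselect (q g = 0).
  by rewrite (qeq0 g g0) (qeq0 h)// -qE.
move: E; rewrite qE => /(congr1 (fun w => sc_of (q h)^-1 *: w)).
by rewrite !scalerA -sc_ofM mulVf ?sc_of1 ?scale1r//; apply/eqP; rewrite -qE.
Qed.

End renorming.

(** * Normalised bases and the conclusion *)

Lemma linear_span_scale (R : realType) (k : scalar_kind)
    (V : lmodType (scalars R k)) (I : Type) (x : I -> V) (t : I -> scalars R k) :
  (forall i, t i != 0) ->
  linear_span x `<=` linear_span (fun i => t i *: x i).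
Proof.
move=> t0 _ [s ->]; exists [seq (p.1 / t p.2, p.2) | p <- s].
by rewrite big_map; apply: eq_bigr => p _ /=; rewrite scalerA divfK.
Qed.

(** Each [x i] is divided by its norm and [f i] multiplied by it. *)
Lemma normalized_markushevich_basis (R : realType) (k : scalar_kind)
    (X : normedModType (scalars R k)) : has_shrinking_markushevich_basis X ->
  exists (I : choiceType) (x : I -> X) (f : I -> dual X),
    [/\ forall i, f i (x i) = 1, forall i j, i <> j -> f i (x j) = 0,
        forall i, rn (x i) <= 1, closure (linear_span x) = setT
      & closure (linear_span f) = setT].
Proof.
move=> [I [x [f [fx1 fx xd fd _]]]].
have x0 i : rn (x i) != 0.
  apply/eqP => /rn_eq0 xi0; have := fx1 i; rewrite xi0 linear0 => /eqP.
  by rewrite eq_sym oner_eq0.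
pose t i : scalars R k := sc_of (rn (x i)).
pose u i : scalars R k := sc_of (rn (x i))^-1.
have tu i : t i * u i = 1 by rewrite -sc_ofM mulfV// sc_of1.
have t0 i : t i != 0.
  by apply/eqP => ti; have := tu i; rewrite ti mul0r => /eqP; rewrite eq_sym oner_eq0.
have u0 i : u i != 0.
  by apply/eqP => ui; have := tu i; rewrite ui mulr0 => /eqP; rewrite eq_sym oner_eq0.
exists {classic I}, (fun i => u i *: x i), (fun i => t i *: f i); split.
- by move=> i; rewrite dualZE dual_mapZ fx1 mulr1.
- by move=> i j /fx fij; rewrite dualZE dual_mapZ fij !mulr0.
- move=> i; rewrite rnZ rn_sc_of ?invr_ge0 ?rn_ge0// mulVf//.
- apply/seteqP; split=> // y _.
  by apply: (closureS (linear_span_scale u0)); rewrite xd.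
- apply/seteqP; split=> // y _.
  by apply: (closureS (linear_span_scale t0)); rewrite fd.
Qed.

Theorem theorem4p3 (R : realType) (k : scalar_kind)
    (X : completeNormedModType (scalars R k))
    (a c : scalars R k) (B : set (scalars R k)) :
  0 <= a -> 0 <= c -> compact B ->
  strict_aBc_ideal a B c (range (@bidual_embedding R k X)) ->
  has_shrinking_markushevich_basis X ->
  exists N : equivalent_norm X,
    [/\ smooth (renormed N), strictly_convex (dual (renormed N))
      & canonical_aBc_ideal a B c (renormed N)].
Proof.
move=> _ c0 _ [P [[clX P_ideal idX] P_norming]].
move=> /normalized_markushevich_basis[I [x [f [fx1 fx x1 x_dense f_dense]]]].
have canX : canonical_aBc_ideal a B c X.
  split=> //; first exact: natural_projection_ideal.
  move=> b Bb phi.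
  rewrite -(ideal_projection_natural P_ideal P_norming fx x_dense f_dense).
  exact: idX.
have q_seminorm := day_norm_seminorm x1.
have q_rn := day_norm_rn x1.
have [clR _ _] := clX.
have q_dom F := day_dominated_embedding fx1 fx x1 x_dense f_dense clR (F := F).
have sc := @renormed_strictly_convex _ _ _ _ q_seminorm q_rn q_dom
  (day_norm_strict fx1 fx x1 x_dense f_dense) (day_norm_eq0 x1 x_dense).
exists (predual_renorming q_seminorm q_rn); split=> //.
  exact: strictly_convex_dual_smooth.
exact: renormed_canonical.
Qed.
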